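(* Let $R$ be a commutative unital ring. For every integer $n\geq 2$, the standard identity of degree $4n-2$ is a polynomial identity of both $M_nE^2$ and $M_nE^3$.
   Context: $E^m=R\langle v_1,\dots,v_m\rangle/(v_i^2,\ v_iv_j+v_jv_i \mid 1\le i,j\le m)$ is the $m$-generated Grassmann algebra over $R$, and $M_nE^m$ is the ring of $n\times n$ matrices over $E^m$. The standard polynomial of degree $k$ is $s_k(x_1,\dots,x_k)=\sum_{\pi\in\mathfrak{S}_k}\mathrm{sgn}(\pi)x_{\pi(1)}\cdots x_{\pi(k)}$; it is a polynomial identity if it vanishes for all substitutions of elements of the algebra. *)

(* Defs.v *)
From mathcomp Require Import all_boot all_order all_fingroup all_algebra.
Set Implicit Arguments. Unset Strict Implicit. Unset Printing Implicit Defensive.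
Import GRing.Theory.
Local Open Scope ring_scope.

(* The m-generated Grassmann algebra E^m over R, in its standard basis model:
   an element is the family of its coordinates on the basis monomials
   e_S = v_{i1} ... v_{ik} (i1 < ... < ik, S = {i1,...,ik} a subset of 'I_m). *)
Definition grass (R : comPzRingType) (m : nat) := {ffun {set 'I_m} -> R}.

(* number of inversions when concatenating the sorted monomials e_S and e_T *)
Definition grinv (m : nat) (S T : {set 'I_m}) : nat :=
  #|[set p : 'I_m * 'I_m | (p.1 \in S) && (p.2 \in T) && (p.2 < p.1)%N]|.

(* multiplication: e_S e_T = 0 if S, T meet, else (-1)^inv(S,T) e_(S u T) *)
Definition grmul (R : comPzRingType) (m : nat) (a b : grass R m) : grass R m :=
  [ffun U : {set 'I_m} => \sum_(S : {set 'I_m}) \sum_(T : {set 'I_m})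
     (if (S :&: T == set0) && (S :|: T == U)
      then (-1) ^+ grinv S T * a S * b T else 0)].

Definition grone (R : comPzRingType) (m : nat) : grass R m :=
  [ffun S : {set 'I_m} => if S == set0 then 1 else 0].

Definition grmxmul (R : comPzRingType) (m n : nat) (A B : 'M[grass R m]_n)
  : 'M[grass R m]_n :=
  \matrix_(i, j) \sum_(k < n) grmul (A i k) (B k j).

Definition grmx1 (R : comPzRingType) (m n : nat) : 'M[grass R m]_n :=
  \matrix_(i, j) (if i == j then grone R m else 0).

Definition grmxprod (R : comPzRingType) (m n : nat) (l : seq 'M[grass R m]_n)
  : 'M[grass R m]_n := foldr (@grmxmul R m n) (grmx1 R m n) l.

Definition std_poly (R : comPzRingType) (m n k : nat) (x : 'I_k -> 'M[grass R m]_n)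
  : 'M[grass R m]_n :=
  \sum_(s : 'S_k)
    (if odd_perm s then - grmxprod [seq x (s i) | i <- enum 'I_k]
     else grmxprod [seq x (s i) | i <- enum 'I_k]).

Definition std_identity (R : comPzRingType) (m n k : nat) : Prop :=
  forall x : 'I_k -> 'M[grass R m]_n, std_poly x = 0.

(* Main.v *)
(** The identity is multilinear, so it may be checked on matrix units times basis
    monomials, hence over [int]. Let [Lam] be a Grassmann algebra over [int] with
    enough generators [theta_i], and [Y := \sum_i theta_i x_i], where the [theta_i]
    commute with the [v_j]; then [Y ^+ N] is [theta_1 ... theta_N] times the
    standard polynomial of the [x_i].

    Write [d] for the matrix size. An odd matrix [A] over [Lam] satisfies
    [A ^+ (2 * d) = 0] (Rosset's proof of the Amitsur-Levitzki theorem). Its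
    polarization says that [\sum_(i + j = s) A^i B A^j = 0] for [s >= 2 * d - 1] and
    [B] odd, and the same with signs [(-1)^i] for [B] even. For
    [i + j + k = 4 * d - 4] the traces [tr (D A^i B A^j C A^k)] are cyclically
    invariant, and both families of relations make their sums along the lines of
    the triangle of exponents vanish, except on the boundary; weighting the lines
    by their distance to the boundary shows that the total sum vanishes. This is
    where [d >= 2] is needed. So [\sum_(i + j + k = 4 * d - 4) A^i B A^j C A^k = 0].

    Expanding [Y ^+ (4 * d - 2)] in the degree with respect to the [v_j], degrees
    0 and 1 vanish by the polarized nilpotency and degree 2 by the last identity;
    the derivative of the latter in [A] is a shuffle relation, which kills the
    alternating sum in degree 3. There is no higher degree for at most three
    [v_j].

    The polarizations are obtained with nilpotent parameters (products of spare
    generators of [Lam]), which multiply the identities until the end. *)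
Require Import Defs.
From HB Require Import structures.
From mathcomp Require Import all_boot all_order all_fingroup all_algebra.
From mathcomp Require Import zify.
Set Implicit Arguments. Unset Strict Implicit. Unset Printing Implicit Defensive.
Import GRing.Theory.
Local Open Scope ring_scope.

(** * Exterior algebras over a ring *)

Section GrassSign.
Variable m : nat.
Implicit Types S T U : {set 'I_m}.

Lemma grinvUl S T U : [disjoint S & T] ->
  grinv (S :|: T) U = (grinv S U + grinv T U)%N.
Proof.
move=> dST; rewrite /grinv -cardsUI.
set X := (X in (_ + X)%N); have -> : X = 0.
  apply/eqP; rewrite cards_eq0; apply/eqP/setP => p; rewrite !inE.
  apply/negP => /andP[/andP[/andP[h _] _] /andP[/andP[h' _] _]].
  by move/pred0P: dST => /(_ p.1) /=; rewrite h h'.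
by rewrite addn0; apply: eq_card => p; rewrite !inE -!andbA -andb_orl.
Qed.

Lemma grinvUr S T U : [disjoint T & U] ->
  grinv S (T :|: U) = (grinv S T + grinv S U)%N.
Proof.
move=> dTU; rewrite /grinv -cardsUI.
set X := (X in (_ + X)%N); have -> : X = 0.
  apply/eqP; rewrite cards_eq0; apply/eqP/setP => p; rewrite !inE.
  apply/negP => /andP[/andP[/andP[_ h] _] /andP[/andP[_ h'] _]].
  by move/pred0P: dTU => /(_ p.2) /=; rewrite h h'.
rewrite addn0; apply: eq_card => p; rewrite !inE -!andbA.
by case: (p.1 \in S); case: (p.2 \in T); case: (p.2 \in U); case: (_ < _)%N.
Qed.

Lemma grinv0l T : grinv set0 T = 0%N.
Proof. by apply/eqP; rewrite cards_eq0; apply/eqP/setP => p; rewrite !inE. Qed.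

Lemma grinv0r S : grinv S set0 = 0%N.
Proof. by apply/eqP; rewrite cards_eq0; apply/eqP/setP => p; rewrite !inE andbF. Qed.

(** Each pair in the product of [S] and [T] is an inversion in exactly one of the two orders, since
    disjointness excludes equal entries. This count is the source of graded commutativity. *)
Lemma grinvC S T : [disjoint S & T] -> (grinv S T + grinv T S = #|S| * #|T|)%N.
Proof.
move=> dST; rewrite -cardsX {2}/grinv.
have -> : #|[set p : 'I_m * 'I_m | (p.1 \in T) && (p.2 \in S) && (p.2 < p.1)%N]|
        = #|[set p : 'I_m * 'I_m | (p.1 \in S) && (p.2 \in T) && (p.1 < p.2)%N]|.
  pose sw (p : 'I_m * 'I_m) := (p.2, p.1).
  have swK : involutive sw by case.
  rewrite -(card_imset _ (inv_inj swK)); apply: eq_card => p.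
  apply/imsetP/idP => [[q + ->]|]; rewrite !inE /=; first by rewrite (andbC (q.1 \in T)).
  by move=> h; exists (sw p); rewrite ?swK // !inE /= (andbC (p.2 \in T)).
rewrite /grinv -cardsUI; set X := (X in (_ + X)%N); have -> : X = 0.
  apply/eqP; rewrite cards_eq0; apply/eqP/setP => p; rewrite !inE.
  apply/negP => /andP[/andP[_ h] /andP[_ h']].
  by move: (ltn_trans h h'); rewrite ltnn.
rewrite addn0; apply: eq_card => p; rewrite !inE -andb_orr.
case pS: (p.1 \in S); case pT: (p.2 \in T) => //=.
case: ltngtP => // /val_inj e; move/pred0P: dST => /(_ p.1) /=.
by rewrite pS -e pT.
Qed.

End GrassSign.

(* The generators commute with the coefficient ring M, which need not be
   commutative; for a commutative R, [ext R m] is [grass R m]. *)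
Definition ext (M : pzRingType) (m : nat) := {ffun {set 'I_m} -> M}.

Section ExtRing.
Variables (M : pzRingType) (m : nat).
Implicit Types (S T U : {set 'I_m}) (a b c : ext M m) (x y z : M).

HB.instance Definition _ := GRing.Zmodule.on (ext M m).

Definition emono S x : ext M m := [ffun U => if U == S then x else 0].

Definition extmul a b : ext M m :=
  [ffun U : {set 'I_m} => \sum_(S : {set 'I_m}) \sum_(T : {set 'I_m})
     (if (S :&: T == set0) && (S :|: T == U)
      then (-1) ^+ grinv S T * a S * b T else 0)].

Definition extone : ext M m := [ffun S : {set 'I_m} => if S == set0 then 1 else 0].

Lemma emonoD S x y : emono S (x + y) = emono S x + emono S y.
Proof. by apply/ffunP => U; rewrite !ffunE; case: eqP; rewrite ?addr0. Qed.

Lemma emono0 S : emono S 0 = 0.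
Proof. by apply/ffunP => U; rewrite !ffunE; case: eqP. Qed.

Lemma ext_sumE I (r : seq I) (P : pred I) (F : I -> ext M m) S :
  (\sum_(i <- r | P i) F i) S = \sum_(i <- r | P i) F i S.
Proof. by elim/big_rec2: _ => [|i y1 y2 _ <-]; rewrite ffunE. Qed.

Lemma ext_decomp a : a = \sum_S emono S (a S).
Proof.
apply/ffunP => U; rewrite ext_sumE (bigD1 U) //= ffunE eqxx big1 ?addr0 // => S.
by rewrite ffunE eq_sym => /negPf ->.
Qed.

Lemma extmulE a b : extmul a b = \sum_(S : {set 'I_m}) \sum_(T : {set 'I_m})
  (if [disjoint S & T] then emono (S :|: T) ((-1) ^+ grinv S T * a S * b T) else 0).
Proof.
apply/ffunP => U; rewrite ffunE ext_sumE; apply: eq_bigr => S _.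
rewrite ext_sumE; apply: eq_bigr => T _; rewrite setI_eq0 eq_sym.
by case: ifP => [/andP[-> /eqP->]|]; rewrite ?ffunE ?eqxx //; case: ifP; rewrite ffunE //= => _ ->.
Qed.

Lemma extmulDl : left_distributive extmul +%R.
Proof.
move=> a b c; rewrite !extmulE -big_split; apply: eq_bigr => S _ /=.
rewrite -big_split; apply: eq_bigr => T _ /=.
by case: ifP; rewrite ?addr0 // ffunE mulrDr mulrDl emonoD.
Qed.

Lemma extmulDr : right_distributive extmul +%R.
Proof.
move=> a b c; rewrite !extmulE -big_split; apply: eq_bigr => S _ /=.
rewrite -big_split; apply: eq_bigr => T _ /=.
by case: ifP; rewrite ?addr0 // ffunE mulrDr emonoD.
Qed.

Lemma extmul0l a : extmul 0 a = 0.
Proof. by apply: (addrI (extmul 0 a)); rewrite -extmulDl !addr0. Qed.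

Lemma extmul0r a : extmul a 0 = 0.
Proof. by apply: (addrI (extmul a 0)); rewrite -extmulDr !addr0. Qed.

Lemma extmul_suml I (r : seq I) (P : pred I) (F : I -> ext M m) a :
  extmul (\sum_(i <- r | P i) F i) a = \sum_(i <- r | P i) extmul (F i) a.
Proof. exact: (big_morph (extmul^~ a) (fun b c => extmulDl b c a) (extmul0l a)). Qed.

Lemma extmul_sumr I (r : seq I) (P : pred I) (F : I -> ext M m) a :
  extmul a (\sum_(i <- r | P i) F i) = \sum_(i <- r | P i) extmul a (F i).
Proof. exact: (big_morph (extmul a) (extmulDr a) (extmul0r a)). Qed.

Lemma extmul_mono S T x y : extmul (emono S x) (emono T y) =
  if [disjoint S & T] then emono (S :|: T) ((-1) ^+ grinv S T * x * y) else 0.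
Proof.
rewrite extmulE (bigD1 S) //= [X in _ + X]big1 ?addr0 => [|S' /negPf nS]; last first.
  rewrite big1 // => T' _; rewrite ffunE nS mulr0 mul0r emono0; by case: ifP.
rewrite (bigD1 T) //= [X in _ + X]big1 ?addr0 => [|T' /negPf nT]; last first.
  rewrite [X in _ * X]ffunE nT mulr0 emono0; by case: ifP.
by rewrite !ffunE !eqxx.
Qed.

(** Distributivity reduces this to monomials, where both bracketings carry the sum of the three
    pairwise inversion counts as exponent of -1. *)
Lemma extmulA : associative extmul.
Proof.
move=> a b c; rewrite (ext_decomp a) !extmul_suml; apply: eq_bigr => S _.
rewrite (ext_decomp b) extmul_suml !extmul_sumr extmul_suml; apply: eq_bigr => T _.
rewrite (ext_decomp c) !extmul_sumr; apply: eq_bigr => U _.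
rewrite !extmul_mono.
have dU : [disjoint S :|: T & U] = [disjoint S & U] && [disjoint T & U].
  by rewrite -!setI_eq0 setIUl setU_eq0.
have dU' : [disjoint S & T :|: U] = [disjoint S & T] && [disjoint S & U].
  by rewrite -!setI_eq0 setIUr setU_eq0.
case dTU : [disjoint T & U]; case dST : [disjoint S & T];
  rewrite ?extmul_mono ?extmul0l ?extmul0r ?dU ?dU' ?dST ?dTU ?andbF //=.
case dSU: [disjoint S & U] => //=.
rewrite setUA; congr emono.
rewrite grinvUl // grinvUr // !exprD !mulrA.
do 2 congr (_ * _); rewrite -mulrA (commr_sign (a S)) mulrA; congr (_ * _).
by rewrite -!exprD; congr (_ ^+ _); rewrite addnAC -addnA addnC -addnA addnC addnAC.
Qed.

Lemma extmul1l : left_id extone extmul.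
Proof.
move=> a; have -> : extone = emono set0 1 by apply/ffunP => S; rewrite !ffunE.
rewrite {1}(ext_decomp a) extmul_sumr [RHS]ext_decomp; apply: eq_bigr => S _.
by rewrite extmul_mono -setI_eq0 set0I eqxx set0U grinv0l !mul1r.
Qed.

Lemma extmul1r : right_id extone extmul.
Proof.
move=> a; have -> : extone = emono set0 1 by apply/ffunP => S; rewrite !ffunE.
rewrite {1}(ext_decomp a) extmul_suml [RHS]ext_decomp; apply: eq_bigr => S _.
by rewrite extmul_mono -setI_eq0 setI0 eqxx setU0 grinv0r mulr1 mul1r.
Qed.

HB.instance Definition _ := GRing.Zmodule_isPzRing.Build (ext M m)
  extmulA extmul1l extmul1r extmulDl extmulDr.

Lemma emono1 : emono set0 1 = 1.
Proof. by apply/ffunP => S; rewrite !ffunE. Qed.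

Lemma emonoM S T x y : emono S x * emono T y =
  if [disjoint S & T] then emono (S :|: T) ((-1) ^+ grinv S T * x * y) else 0.
Proof. exact: extmul_mono. Qed.

End ExtRing.

Lemma ext_oner_neq0 (M : nzRingType) m : 1 != 0 :> ext M m.
Proof.
apply/eqP => /ffunP/(_ set0); rewrite !ffunE eqxx; apply/eqP; exact: oner_neq0.
Qed.

HB.instance Definition _ (M : nzRingType) m :=
  GRing.PzSemiRing_isNonZero.Build (ext M m) (ext_oner_neq0 M m).

(** * Traces of powers and nilpotency *)

Lemma deriv_prod (L : comNzRingType) (I : eqType) (r : seq I) (F : I -> {poly L}) : uniq r ->
  (\prod_(i <- r) F i)^`() =
  \sum_(i <- r) \prod_(j <- r) (if j == i then (F j)^`() else F j).
Proof.
elim: r => [|i r IH] /=; first by rewrite !big_nil derivC.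
case/andP=> ir ur; rewrite !big_cons derivM IH // eqxx; congr (_ * _ + _).
  by apply: eq_big_seq => j jr; case: eqP jr ir => // -> ->.
rewrite mulr_sumr; apply: eq_big_seq => k kr; rewrite big_cons.
by case: eqP kr ir => // -> ->.
Qed.

(** Jacobi's formula: differentiate one row at a time and expand each resulting determinant along
    that row. *)
Lemma deriv_det (L : comNzRingType) n (P : 'M[{poly L}]_n) :
  (\det P)^`() = \tr (\adj P *m map_mx (fun p => p^`()) P).
Proof.
pose Q i := \matrix_(k, l) (if k == i then (P k l)^`() else P k l).
have -> : (\det P)^`() = \sum_i \det (Q i).
  rewrite /determinant raddf_sum exchange_big /=; apply: eq_bigr => s _.
  rewrite -mulr_sumr -signr_odd; case: (odd _); rewrite ?expr0 ?expr1 ?mul1r ?mulN1r ?derivN.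
    congr (- _); rewrite deriv_prod ?index_enum_uniq //; apply: eq_bigr => i _.
    by apply: eq_bigr => j _; rewrite mxE.
  rewrite deriv_prod ?index_enum_uniq //; apply: eq_bigr => i _.
  by apply: eq_bigr => j _; rewrite mxE.
rewrite mxtrace_mulC; apply: eq_bigr => i _; rewrite (expand_det_row _ i) mxE.
apply: eq_bigr => j _; rewrite !mxE eqxx; congr (_ * _).
rewrite /cofactor; congr (_ * \det _); apply/matrixP => k l; rewrite !mxE.
by rewrite eq_sym (negPf (neq_lift _ _)).
Qed.

(** Serves to bound the degree of the cofactors of 1 - X T. *)
Lemma size_det_leq (L : comNzRingType) n (P : 'M[{poly L}]_n) :
  (forall i j, size (P i j) <= 2)%N -> (size (\det P) <= n.+1)%N.
Proof.
move=> hP; rewrite /determinant; apply: leq_trans (size_sum _ _ _) _.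
apply/bigmax_leqP => s _; rewrite size_Msign.
apply: leq_trans (size_poly_prod_leq _ _) _.
rewrite leq_subLR cardT size_enum_ord addnS ltnS.
apply: (@leq_trans (\sum_(i < n) 2)); first exact: leq_sum.
by rewrite sum_nat_const card_ord muln2 addnn.
Qed.

(* Generating-function form of Newton's identities: the logarithmic derivative
   of det (1 - X T) is - \sum_k tr (T ^ k.+1) X^k, so this determinant is 1 and
   1 - X T has the inverse adj (1 - X T), of degree at most n in X. *)
Lemma nilpotent_of_mxtrace (L : comNzRingType) n (T : 'M[L]_n.+1) :
  (forall (x : L) k, x *+ k.+1 = 0 -> x = 0) ->
  (forall k, \tr (T ^+ k.+1) = 0) -> T ^+ n.+1 = 0.
Proof.
move=> tf trT; pose C := map_mx (@polyC L) T.
pose P : 'M[{poly L}]_n.+1 := 1 - 'X *: C; pose D := \det P.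
have CX k : C ^+ k = map_mx (@polyC L) (T ^+ k) by rewrite /C rmorphXn.
have geomP K : P * (\sum_(k < K) 'X^k *: C ^+ k) = 1 - 'X^K *: C ^+ K.
  elim: K => [|K IH]; first by rewrite big_ord0 mulr0 expr0 scale1r subrr.
  rewrite big_ord_recr mulrDr IH /= /P mulrBl mul1r -scalerAl -scalerAr scalerA.
  by rewrite -!exprS addrA subrK.
(* A finite substitute for the power series of the inverse: the remainder is divisible by X^K, so
   each coefficient can be read off by taking [K] large enough. *)
have adjK K : \adj P = D *: (\sum_(k < K) 'X^k *: C ^+ k) + 'X^K *: (\adj P * C ^+ K).
  have := congr1 (fun Z => \adj P * Z) (geomP K).
  rewrite mulrA -[\adj P * P]/(\adj P *m P) mul_adj_mx -[_%:M * _]/(_%:M *m _) mul_scalar_mx.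
  by rewrite mulrBr mulr1 -scalerAr => ->; rewrite subrK.
have dP : map_mx (fun p => p^`()) P = - C.
  apply/matrixP => i j; rewrite !mxE derivB derivM derivX derivC mulr0 addr0 mul1r.
  by rewrite -polyC_natr derivC sub0r.
have dD : D^`() = 0.
  apply/polyP => K; rewrite coef0 deriv_det dP (adjK K.+1) mulmxN raddfN coefN.
  rewrite mulmxDl raddfD /= -!scalemxAl !linearZ /= coefD coefXnM ltnSn addr0.
  rewrite mulmx_suml raddf_sum /= big1 ?mulr0 ?coef0 ?oppr0 // => k _.
  by rewrite -scalemxAl linearZ /= -[_ *m _]/(_ * _) -exprSr CX trace_map_mx trT rmorph0 mulr0.
have D1 : D = 1.
  apply/polyP => -[|k]; last first.
    have := congr1 (fun p : {poly L} => p`_k) dD.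
    by rewrite coef_deriv coef0 coef1 /= => /tf.
  rewrite coef1 /= -horner_coef0 -[D.[0]]/(horner_eval 0 D) -det_map_mx.
  rewrite -[RHS](@det1 _ n.+1); congr (\det _); apply/matrixP => i j.
  by rewrite !mxE /= /horner_eval hornerD hornerN hornerM hornerX mul0r subr0 -polyC_natr hornerC.
(* Compare the coefficients of X^(n+1): the cofactors have degree at most [n], while the geometric
   sum contributes [T ^+ n.+1]. *)
apply/matrixP => i j; have := congr1 (fun Z : 'M[{poly L}]_n.+1 => (Z i j)`_n.+1) (adjK n.+2).
rewrite !mxE D1 mul1r coefD coefXnM ltnSn addr0 nth_default => [|]; last first.
  rewrite /cofactor size_Msign; apply: size_det_leq => k l; rewrite !mxE.
  apply: leq_trans (size_polyD _ _) _; rewrite geq_max; apply/andP; split.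
    by case: (_ == _); rewrite ?size_poly1 ?size_poly0.
  rewrite size_polyN mulrC; apply: leq_trans (size_polyMleq _ _) _.
  by rewrite size_polyX addn2 /= ltnS size_polyC_leq1.
rewrite summxE coef_sum big_ord_recr big1 /= => [|k _].
  by rewrite !mxE add0r coefXnM ltnn subnn CX mxE coefC.
by rewrite mxE coefXnM ltnNge ltnW //= CX mxE coefC subn_eq0 leqNgt ltn_ord.
Qed.

(** * Parity *)

Section Parity.
Variables (K : comNzRingType) (m : nat).
Implicit Types (a x y : ext K m) (b c : bool).

(** [true] stands for odd. Only the vanishing of the other coordinates is required, so zero has both
    parities. *)
Definition parity b a : Prop := forall S : {set 'I_m}, odd #|S| = ~~ b -> a S = 0.

Lemma parity0 b : parity b 0.
Proof. by move=> S _; rewrite ffunE. Qed.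

Lemma parity1 : parity false 1.
Proof. by move=> S; rewrite ffunE; case: eqP => // ->; rewrite cards0. Qed.

Lemma parityD b x y : parity b x -> parity b y -> parity b (x + y).
Proof. by move=> hx hy S hS; rewrite ffunE hx ?hy ?addr0. Qed.

Lemma parityN b x : parity b x -> parity b (- x).
Proof. by move=> hx S hS; rewrite ffunE hx ?oppr0. Qed.

Lemma parity_sum b I (r : seq I) (P : pred I) (F : I -> ext K m) :
  (forall i, P i -> parity b (F i)) -> parity b (\sum_(i <- r | P i) F i).
Proof. by move=> h; elim/big_rec: _ => [|i x Pi]; [exact: parity0 | apply/parityD/h]. Qed.

Lemma parityM b c x y : parity b x -> parity c y -> parity (b (+) c) (x * y).
Proof.
move=> hx hy U hU; rewrite ffunE big1 // => S _; rewrite big1 // => T _.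
case: ifP => // /andP[/eqP dST /eqP eU].
move: hU; rewrite -eU cardsU dST cards0 subn0 oddD.
case eS: (odd #|S| == b); last first.
  by rewrite hx ?mulr0 ?mul0r //; move: eS; case: (odd _) b {hx} => -[].
move/eqP: eS => ->; case eT: (odd #|T| == c); last first.
  by rewrite hy ?mulr0 //; move: eT; case: (odd _) c {hy} => -[].
by move/eqP: eT => ->; case: (b (+) c).
Qed.

Lemma parity_emono (S : {set 'I_m}) (z : K) : parity (odd #|S|) (emono S z).
Proof. by move=> T hT; rewrite ffunE; case: eqP hT => // ->; case: odd. Qed.

(** Supercommutativity: by [grinvC], exchanging two disjoint monomials costs the sign with exponent
    #|S| * #|T|. *)
Lemma parityC b c x y : parity b x -> parity c y -> x * y = (-1) ^+ (b && c) * (y * x).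
Proof.
move=> hx hy; apply/ffunP => U.
have -> : ((-1) ^+ (b && c) * (y * x)) U = (-1) ^+ (b && c) * (y * x) U.
  by rewrite !mulr_sign; case: (b && c); rewrite ?ffunE.
rewrite !ffunE exchange_big mulr_sumr; apply: eq_bigr => S _ /=.
rewrite mulr_sumr; apply: eq_bigr => T _ /=.
rewrite setIC setUC; case: ifP => [/andP[]|]; last by rewrite mulr0.
rewrite setI_eq0 => dST _.
case eS: (odd #|S| == c); last first.
  by rewrite hy ?mulr0 ?mul0r ?mulr0 //; move: eS; case: (odd _) c {hy} => -[].
case eT: (odd #|T| == b); last first.
  by rewrite hx ?mulr0 ?mul0r ?mulr0 //; move: eT; case: (odd _) b {hx} => -[].
rewrite -(eqP eS) -(eqP eT) andbC -oddM signr_odd -(grinvC dST) exprD -!mulrA.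
by rewrite [RHS]mulrCA signrMK (mulrC (y S)).
Qed.

End Parity.

Section EvenPart.
Variables (K : comNzRingType) (m : nat).

(** The even elements form a commutative ring, over which determinants and Newton's identities are
    available. The boolean form of the condition makes them a subtype. *)
Definition evenp : {pred ext K m} :=
  fun a => [forall S : {set 'I_m}, odd #|S| ==> (a S == 0)].

Lemma evenpP a : reflect (parity false a) (a \in evenp).
Proof.
apply: (iffP forallP) => [h S hS|h S].
  by have := h S; rewrite hS /= => /eqP.
by apply/implyP => hS; rewrite h.
Qed.

Fact evenp_subring : subring_closed evenp.
Proof.
split; first by apply/evenpP/parity1.
  by move=> x y /evenpP hx /evenpP hy; apply/evenpP/parityD => //; apply: parityN.
by move=> x y /evenpP hx /evenpP hy; apply/evenpP; apply: (parityM hx hy).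
Qed.
HB.instance Definition _ := GRing.isSubringClosed.Build (ext K m) evenp evenp_subring.

Definition evenT := {a : ext K m | a \in evenp}.
HB.instance Definition _ := SubType.on evenT.
HB.instance Definition _ := Choice.on evenT.
HB.instance Definition _ := [SubChoice_isSubNzRing of evenT by <:].

Fact evenT_mulC : commutative (@GRing.mul evenT).
Proof.
move=> x y; apply: val_inj; rewrite !rmorphM /=.
have /evenpP hx := valP x; have /evenpP hy := valP y.
by rewrite (parityC hx hy) mul1r.
Qed.
HB.instance Definition _ := GRing.PzRing_hasCommutativeMul.Build evenT evenT_mulC.

End EvenPart.

Section ParityMatrix.
Variables (K : comNzRingType) (m n : nat).
Implicit Types (A B : 'M[ext K m]_n.+1) (b c : bool).

Definition mxparity b A : Prop := forall i j, parity b (A i j).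

Lemma mxparity1 : mxparity false 1.
Proof. by move=> i j; rewrite mxE; case: (i == j); [apply: parity1 | apply: parity0]. Qed.

Lemma mxparityD b A B : mxparity b A -> mxparity b B -> mxparity b (A + B).
Proof. by move=> hA hB i j; rewrite mxE; apply: parityD. Qed.

Lemma mxparityM b c A B : mxparity b A -> mxparity c B -> mxparity (b (+) c) (A * B).
Proof.
move=> hA hB i j; rewrite mxE; apply: parity_sum => k _; exact: parityM.
Qed.

Lemma mxparityX A k : mxparity true A -> mxparity (odd k) (A ^+ k).
Proof.
move=> hA; elim: k => [|k IH]; first exact: mxparity1.
by rewrite exprS; apply: (mxparityM hA IH).
Qed.

Lemma mxparity_scalar b x : parity b x -> mxparity b x%:M.
Proof. by move=> hx i j; rewrite mxE; case: eqP => _; [rewrite mulr1n|rewrite mulr0n; apply: parity0]. Qed.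

Lemma mxtrace_parityC b c A B : mxparity b A -> mxparity c B ->
  \tr (A * B) = (-1) ^+ (b && c) * \tr (B * A).
Proof.
move=> hA hB; rewrite mulr_sumr [LHS](eq_bigr _ (fun i _ => mxE _ _ i i)) exchange_big.
apply: eq_bigr => i _; rewrite mxE mulr_sumr; apply: eq_bigr => j _; exact: parityC.
Qed.

Lemma scalar_parityC b c x A : parity b x -> mxparity c A ->
  A * x%:M = (-1) ^+ (b && c) * (x%:M * A).
Proof.
move=> hx hA; have -> : (-1) ^+ (b && c) * (x%:M * A) = ((-1) ^+ (b && c) *: (x%:M * A)).
  by rewrite mulr_sign -[in RHS]signr_odd; case: (b && c); rewrite ?scaleN1r ?scale1r.
apply/matrixP => i j.
rewrite !mxE (bigD1 j) //= big1 ?addr0 => [|k kj]; last by rewrite mxE (negPf kj) mulr0n mulr0.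
rewrite (bigD1 i) //= big1 ?addr0 => [|k ki]; last by rewrite mxE eq_sym (negPf ki) mulr0n mul0r.
by rewrite !mxE !eqxx !mulr1n andbC; apply: parityC.
Qed.

End ParityMatrix.

(** The reason for working over [int]: positive integer factors can be cancelled. *)
Lemma ext_int_torsion_free m (x : ext int m) k : x *+ k.+1 = 0 -> x = 0.
Proof.
move=> h; apply/ffunP => S; have := congr1 (fun y : ext int m => y S) h.
rewrite ffunMnE !ffunE => /eqP; by rewrite Num.Theory.mulrn_eq0 /= => /eqP.
Qed.

(* Rosset's argument: the entries of A ^+ 2 commute, and the trace of an even
   power of A is minus itself because the entries of A anticommute. *)
Lemma odd_matrix_nilpotent m n (A : 'M[ext int m]_n.+1) :
  mxparity true A -> A ^+ (2 * n.+1) = 0.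
Proof.
move=> hA; have hT : mxparity false (A ^+ 2) by exact: (mxparityX (k := 2) hA).
(* The square of [A], read over the commutative even ring; by [hT] the default 0 of [insubd] is
   never taken. *)
pose T : 'M[evenT int m]_n.+1 := \matrix_(i, j) insubd 0 ((A ^+ 2) i j).
have TE : map_mx val T = A ^+ 2.
  by apply/matrixP => i j; rewrite mxE [T i j]mxE insubdK //; apply/evenpP; apply: hT.
have TX k : map_mx val (T ^+ k) = A ^+ (2 * k) by rewrite rmorphXn /= TE exprM.
rewrite -TX nilpotent_of_mxtrace ?map_mx0 //.
  move=> x k hx; apply: val_inj; apply: (@ext_int_torsion_free _ _ k).
  by rewrite -(rmorphMn val) /= hx.
move=> k; apply: val_inj; rewrite -trace_map_mx TX mulnS !addSn add0n.
apply: (@ext_int_torsion_free _ _ 1); rewrite mulr2n exprS.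
rewrite {1}(mxtrace_parityC hA (mxparityX hA)) -exprSr -exprS /= oddM /=.
by rewrite expr1 mulN1r addNr.
Qed.

(** * Resolvents *)

(** [G] behaves like the infinitesimal of the dual numbers. *)
Lemma dual_mul (S : pzRingType) (G P Q P' Q' : S) :
  (forall x, G * x = x * G) -> G * G = 0 ->
  (P + G * Q) * (P' + G * Q') = P * P' + G * (Q * P' + P * Q').
Proof.
move=> Gc GG; rewrite mulrDl !mulrDr -addrA; congr (_ + _).
rewrite (mulrA P G) -(Gc P) (mulrA (G * Q) G) -(mulrA G Q G) -(Gc Q) (mulrA G G) GG !mul0r.
by rewrite addr0 addrC !mulrA.
Qed.

(** Leibniz's rule for r B r C r when [r] receives the infinitesimal increment r D r. *)
Lemma dual_mul5 (S : pzRingType) (G r B C D : S) :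
  (forall x, G * x = x * G) -> G * G = 0 ->
  let r' := r + G * (r * D * r) in
  r' * B * r' * C * r' = r * B * r * C * r +
  G * (r * D * r * B * r * C * r + r * B * r * D * r * C * r + r * B * r * C * r * D * r).
Proof.
move=> Gc GG r'; have dC x y z : (x + G * y) * z = x * z + G * (y * z) by rewrite mulrDl mulrA.
by rewrite /r' dC dual_mul // dC dual_mul // !mulrDl !mulrA.
Qed.

Section Resolvent.
Variable V : nzRingType.
Implicit Types (A B C e : V) (G Q R U : {poly V}).

(** The truncated geometric series; if [A ^+ d = 0], it is the inverse of 1 - A X. *)
Definition resolvent d A : {poly V} := \poly_(i < d) A ^+ i.

Lemma resolvent_sum d A : resolvent d A = \sum_(i < d) (A ^+ i)%:P * 'X^i.
Proof. by rewrite /resolvent poly_def; apply: eq_bigr => i _; rewrite mul_polyC. Qed.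

Lemma resolvent_geom d A : resolvent d A = \sum_(i < d) (A%:P * 'X) ^+ i.
Proof.
rewrite resolvent_sum; apply: eq_bigr => i _.
by rewrite exprMn_comm ?rmorphXn //; apply: commr_polyX.
Qed.

Lemma mul_resolvent d A : A ^+ d = 0 -> (1 - A%:P * 'X) * resolvent d A = 1.
Proof.
move=> Ad; rewrite -opprB mulNr resolvent_geom -subrX1 opprB exprMn_comm; last exact: commr_polyX.
by rewrite -rmorphXn /= Ad mul0r subr0.
Qed.

(** The resolvent is a sum of powers of A X, hence commutes with 1 - A X and is a two-sided
    inverse. *)
Lemma resolvent_uniq d A Q : A ^+ d = 0 -> (1 - A%:P * 'X) * Q = 1 -> Q = resolvent d A.
Proof.
move=> Ad UQ; have RU : resolvent d A * (1 - A%:P * 'X) = 1.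
  rewrite -[RHS](mul_resolvent Ad); apply: commrB; first exact: commr1.
  apply: commr_sym; rewrite resolvent_geom; apply: commr_sum => i _.
  exact/commrX/commr_refl.
by rewrite -[Q]mul1r -RU -mulrA UQ mulr1.
Qed.

Lemma central_polyC e : (forall x, e * x = x * e) -> forall Q, e%:P * Q = Q * e%:P.
Proof. by move=> ec Q; apply/polyP => i; rewrite coefCM coefMC. Qed.

(** The first-order expansion of the inverse of U - G Q, exact because [G] squares to zero. *)
Lemma perturbed_inverse U R G Q : U * R = 1 -> (forall P, G * P = P * G) -> G * G = 0 ->
  (U - G * Q) * (R + G * (R * Q * R)) = 1.
Proof.
move=> UR Gc GG; rewrite mulrBl !mulrDr UR (mulrA U G) -(Gc U) -mulrA !(mulrA U) UR mul1r.
rewrite -(mulrA G Q (G * _)) (mulrA Q) -(Gc Q) -(mulrA G Q) (mulrA G G) GG mul0r addr0.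
by rewrite -!mulrA addrK.
Qed.

Lemma first_order_resolvent d A B e : (forall x, e * x = x * e) -> e * e = 0 ->
  A ^+ d = 0 -> (A + e * B) ^+ d = 0 ->
  resolvent d (A + e * B) =
  resolvent d A + e%:P * 'X * (resolvent d A * B%:P * resolvent d A).
Proof.
move=> ec ee Ad ABd; symmetry; apply: resolvent_uniq => //.
have -> : (A + e * B)%:P * 'X = A%:P * 'X + e%:P * 'X * B%:P.
  by rewrite polyCD polyCM mulrDl -!mulrA (commr_polyX B%:P).
rewrite opprD addrA.
apply: perturbed_inverse; first exact: mul_resolvent.
  by move=> Q; rewrite -mulrA -(commr_polyX Q) mulrA central_polyC // mulrA.
by rewrite -mulrA (mulrA 'X) -(commr_polyX e%:P) !mulrA -polyCM ee !mul0r.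
Qed.

(** Polarized nilpotency: both resolvents have degree below [d], so their coefficients of index s +
    1 vanish, and with them the first-order term. Its factor X shifts the index to [s]. *)
Lemma coef_resolvent2_eq0 d A B e s : (forall x, e * x = x * e) -> e * e = 0 ->
  A ^+ d = 0 -> (A + e * B) ^+ d = 0 -> (d <= s.+1)%N ->
  e * (resolvent d A * B%:P * resolvent d A)`_s = 0.
Proof.
move=> ec ee Ad ABd ds.
have /(congr1 (fun Q : {poly V} => Q`_s.+1)) := first_order_resolvent ec ee Ad ABd.
by rewrite coefD !coef_poly ltnNge ds /= add0r -mulrA coefCM coefXM.
Qed.

Lemma mul_monomial A B i j : (A%:P * 'X^i) * (B%:P * 'X^j) = (A * B)%:P * 'X^(i + j).
Proof. by rewrite -mulrA (mulrA 'X^i) -(commr_polyXn _ i) -mulrA -exprD mulrA -polyCM. Qed.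

Lemma mul_monomialC A B i : (A%:P * 'X^i) * B%:P = (A * B)%:P * 'X^i.
Proof. by rewrite -mulrA -commr_polyXn mulrA -polyCM. Qed.

Lemma coef_resolvent2 d A B s : (resolvent d A * B%:P * resolvent d A)`_s =
  \sum_(i < d) \sum_(j < d) (A ^+ i * B * A ^+ j) *+ (i + j == s)%N.
Proof.
rewrite !resolvent_sum !mulr_suml coef_sum; apply: eq_bigr => i _.
rewrite mulr_sumr coef_sum; apply: eq_bigr => j _.
by rewrite mul_monomialC mul_monomial coefCM coefXn eq_sym mulr_natr.
Qed.

Lemma coef_resolvent3 d A B C s :
  (resolvent d A * B%:P * resolvent d A * C%:P * resolvent d A)`_s =
  \sum_(i < d) \sum_(j < d) \sum_(k < d)
     (A ^+ i * B * A ^+ j * C * A ^+ k) *+ (i + j + k == s)%N.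
Proof.
rewrite !resolvent_sum !mulr_suml coef_sum; apply: eq_bigr => i _.
rewrite [X in X * C%:P]mulr_sumr !mulr_suml coef_sum; apply: eq_bigr => j _.
rewrite mulr_sumr coef_sum; apply: eq_bigr => k _.
rewrite mul_monomialC mul_monomial mul_monomialC mul_monomial.
by rewrite coefCM coefXn eq_sym mulr_natr.
Qed.

(** An identity valid at [A] and at A + e D holds for its derivative in the direction [D], up to the
    factor [e]. Differentiating a resolvent brings in one X, so the index drops by one. *)
Lemma coef_resolvent3_derivative d A B C D e lam s :
  (forall x, e * x = x * e) -> e * e = 0 -> A ^+ d = 0 -> (A + e * D) ^+ d = 0 ->
  let r := resolvent d A in let r' := resolvent d (A + e * D) in
  lam * (r * B%:P * r * C%:P * r)`_s = 0 -> lam * (r' * B%:P * r' * C%:P * r')`_s = 0 ->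
  (0 < s)%N ->
  lam * e * (r * D%:P * r * B%:P * r * C%:P * r + r * B%:P * r * D%:P * r * C%:P * r +
             r * B%:P * r * C%:P * r * D%:P * r)`_s.-1 = 0.
Proof.
move=> ec ee Ad ABd r r'; case: s => [_ _|s h0]; first by rewrite ltnn.
have Gc Q : e%:P * 'X * Q = Q * (e%:P * 'X).
  by rewrite -mulrA -(commr_polyX Q) mulrA central_polyC // mulrA.
have GG : e%:P * 'X * (e%:P * 'X) = 0 :> {poly V}.
  by rewrite -mulrA (mulrA 'X) -(commr_polyX e%:P) !mulrA -polyCM ee !mul0r.
rewrite /r' (first_order_resolvent ec ee Ad ABd) -/r (dual_mul5 _ _ _ _ Gc GG).
by rewrite coefD mulrDr h0 add0r -(mulrA e%:P 'X) coefCM coefXM mulrA.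
Qed.

End Resolvent.

(** * Weighted sums over triples of exponents *)

Section TripleSum.
Variables (Z : zmodType) (d : nat).
Hypothesis tf : forall (x : Z) k, x *+ k.+1 = 0 -> x = 0.
Hypothesis d2 : (2 <= d)%N.
Implicit Type f : nat -> nat -> nat -> Z.

Definition sum3 f := \sum_(i < 2 * d) \sum_(j < 2 * d) \sum_(k < 2 * d) f i j k.

Lemma sum3_rot f : sum3 (fun i j k => f j k i) = sum3 f.
Proof.
rewrite /sum3 exchange_big /=; apply: eq_bigr => i _; rewrite exchange_big /=.
by apply: eq_bigr => j _.
Qed.

Lemma sum3D f g : sum3 (fun i j k => f i j k + g i j k) = sum3 f + sum3 g.
Proof.
rewrite /sum3 -big_split; apply: eq_bigr => i _.
by rewrite -big_split; apply: eq_bigr => j _; rewrite -big_split.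
Qed.

Lemma sum3Mn f c : sum3 (fun i j k => f i j k *+ c) = sum3 f *+ c.
Proof.
rewrite /sum3 -sumrMnl; apply: eq_bigr => i _.
by rewrite -sumrMnl; apply: eq_bigr => j _; rewrite -sumrMnl.
Qed.

Lemma eq_sum3 f g : (forall i j k, (i < 2 * d)%N -> (j < 2 * d)%N -> (k < 2 * d)%N ->
  f i j k = g i j k) -> sum3 f = sum3 g.
Proof. by move=> h; do 3 (apply: eq_bigr => ? _); exact: h. Qed.

(** These are the [k] for which i + j = 4d - 4 - k reaches 2d - 1, where polarized nilpotency
    starts. *)
Definition lines_vanish f := forall k, (k.+2 < 2 * d)%N ->
  \sum_(i < 2 * d) \sum_(j < 2 * d) f i j k = 0.

(** The weight is zero at k = 2d - 2 and k = 2d - 1, the lines below 2d that [lines_vanish] leaves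
    out. *)
Let w k := (d.-1 - k./2)%N.

Lemma weighted_sum3 f : lines_vanish f -> sum3 (fun i j k => f i j k *+ w k) = 0.
Proof.
move=> hf; rewrite -sum3_rot /sum3 big1 // => k _.
transitivity ((\sum_(i < 2 * d) \sum_(j < 2 * d) f i j k) *+ w k).
  rewrite -sumrMnl; apply: eq_bigr => i _; by rewrite -sumrMnl; apply: eq_bigr.
have [hk|hk] := ltnP k.+2 (2 * d); first by rewrite hf // mul0rn.
have -> : w k = 0%N by rewrite /w; lia.
by rewrite mulr0n.
Qed.

Lemma weighted_sum3_all f : lines_vanish f -> lines_vanish (fun i j k => f j k i) ->
  lines_vanish (fun i j k => f k i j) ->
  sum3 (fun i j k => f i j k *+ (w i + w j + w k)%N) = 0.
Proof.
move=> h1 h2 h3.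
rewrite (@eq_sum3 _ (fun i j k => (f i j k *+ w i + f i j k *+ w j) + f i j k *+ w k)); last first.
  by move=> i j k _ _ _; rewrite -!mulrnDr.
rewrite !sum3D weighted_sum3 // addr0.
rewrite -[X in X + _]sum3_rot -[X in X + _]sum3_rot -[X in _ + X]sum3_rot.
by rewrite (weighted_sum3 h3) (weighted_sum3 h2) addr0.
Qed.

(* For exponents below 2 * d adding up to 4 * d - 4, the weights d - 1 - i./2 add
   up to d - 1 if all three are even, and to d if two of them are odd. *)
Lemma sum3_eq0 f :
  (forall i j k, (i + j + k != 4 * d - 4)%N -> f i j k = 0) ->
  let fe := fun i j k => f i j k *+ (~~ odd i && ~~ odd j && ~~ odd k) in
  [/\ lines_vanish f, lines_vanish (fun i j k => f j k i) & lines_vanish (fun i j k => f k i j)] ->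
  [/\ lines_vanish fe, lines_vanish (fun i j k => fe j k i) & lines_vanish (fun i j k => fe k i j)] ->
  sum3 f = 0.
Proof.
move=> hf fe [h1 h2 h3] [g1 g2 g3].
have := weighted_sum3_all h1 h2 h3; have := weighted_sum3_all g1 g2 g3.
rewrite (@eq_sum3 _ (fun i j k => fe i j k *+ d.-1)); last first.
  move=> i j k hi hj hk; rewrite /fe -!mulrnA.
  have [h|/hf->] := eqVneq (i + j + k)%N (4 * d - 4)%N; last by rewrite !mul0rn.
  by congr (_ *+ _); case: (boolP (_ && _)) => // /andP[/andP[]]; rewrite /w; lia.
(* By [d2] the factor d - 1 is positive and can be cancelled, so the all-even part has sum zero. *)
have -> : d.-1 = d.-2.+1 by lia.
rewrite sum3Mn => /tf e0.
(* The weight is d, lowered by one on the all-even triples. *)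
rewrite (@eq_sum3 _ (fun i j k => f i j k *+ d - fe i j k)); last first.
  move=> i j k hi hj hk; rewrite /fe.
  have [h|/hf->] := eqVneq (i + j + k)%N (4 * d - 4)%N; last by rewrite !mul0rn subr0.
  rewrite -mulrnBr; last by case: (_ && _) => //; lia.
  congr (_ *+ _); rewrite /w; case: (boolP (_ && _)) => [/andP[/andP[]]|]; lia.
rewrite sum3D sum3Mn.
have -> : sum3 (fun i j k => - fe i j k) = - sum3 fe.
  by rewrite /sum3 -sumrN; apply: eq_bigr => i _; rewrite -sumrN; apply: eq_bigr => j _; rewrite -sumrN.
rewrite e0 subr0; have -> : d = d.-1.+1 by lia.
by move/tf.
Qed.

End TripleSum.

(** * Odd matrices *)

Lemma even_central (K : comNzRingType) m (e : ext K m) : parity false e ->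
  forall x, e * x = x * e.
Proof.
move=> he x; rewrite (ext_decomp x) mulr_sumr mulr_suml; apply: eq_bigr => S _.
by rewrite (parityC he (@parity_emono _ _ S _)) mul1r.
Qed.

Lemma scalar_central (S : pzRingType) n (e : S) : (forall x, e * x = x * e) ->
  forall A : 'M[S]_n, e%:M * A = A * e%:M.
Proof.
move=> ec A; apply/matrixP => i j.
rewrite !mxE (bigD1 i) //= [RHS](bigD1 j) //= !big1 ?addr0.
- by rewrite !mxE !eqxx !mulr1n ec.
- by move=> k kj; rewrite mxE (negPf kj) mulr0n mulr0.
- by move=> k ki; rewrite mxE eq_sym (negPf ki) mulr0n mul0r.
Qed.

Lemma mxtrace_scalarM (S : pzRingType) n (x : S) (A : 'M[S]_n.+1) : \tr (x%:M * A) = x * \tr A.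
Proof. by rewrite -mxtraceZ -mul_scalar_mx. Qed.

Lemma signrCA (S : pzRingType) k (x y : S) : (-1) ^+ k * (x * y) = x * ((-1) ^+ k * y).
Proof. by rewrite !mulrA commr_sign. Qed.

Lemma mxtrace_signM (S : pzRingType) n k (A : 'M[S]_n.+1) :
  \tr ((-1) ^+ k * A) = (-1) ^+ k * \tr A.
Proof.
rewrite -signr_odd -[in RHS]signr_odd.
by case: (odd k); rewrite ?expr1 ?expr0 ?mulN1r ?mul1r ?raddfN.
Qed.

Section OddMatrices.
Variables (m n : nat).
Local Notation Lam := (ext int m).
Local Notation d := n.+1.
Hypothesis n1 : (1 <= n)%N.
Variables (e eta : Lam).
Hypotheses (he : parity false e) (hee : e * e = 0) (heta : parity true eta).
Implicit Types (A B C D W : 'M[Lam]_n.+1).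

Local Notation res A := (resolvent (2 * d) A).

(** A + e B is again odd, hence nilpotent of the same order. *)
Lemma odd_polarization A B s : mxparity true A -> mxparity true B -> (2 * d <= s.+1)%N ->
  e%:M * (res A * B%:P * res A)`_s = 0.
Proof.
move=> hA hB hs; apply: coef_resolvent2_eq0 => //.
- exact/scalar_central/even_central.
- by rewrite -[_ * _]scalar_mxM hee raddf0.
- exact: odd_matrix_nilpotent.
apply: odd_matrix_nilpotent; apply: mxparityD => //.
exact: (mxparityM (mxparity_scalar he) hB).
Qed.

(** The odd case for B = eta W; pulling the odd scalar [eta] to the left through A^i produces the
    sign (-1)^i. *)
Lemma even_polarization A W s : mxparity true A -> mxparity false W -> (2 * d <= s.+1)%N ->
  (e * eta)%:M * (\sum_(i < 2 * d) \sum_(j < 2 * d)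
     (-1) ^+ i * (A ^+ i * W * A ^+ j) *+ (i + j == s)%N) = 0.
Proof.
move=> hA hW hs.
have hB := mxparityM (mxparity_scalar heta) hW.
have := odd_polarization hA hB hs; rewrite coef_resolvent2 => h0; rewrite -[RHS]h0.
rewrite scalar_mxM -[_ *m _]/(_ * _) -mulrA; congr (_ * _); rewrite mulr_sumr; apply: eq_bigr => i _.
rewrite mulr_sumr; apply: eq_bigr => j _.
rewrite mulrnAr; congr (_ *+ _).
rewrite [A ^+ i * (_ * W)]mulrA (scalar_parityC heta (mxparityX hA)) /= signr_odd.
by rewrite -signrCA -!mulrA.
Qed.

Lemma mxtrace_sum2 (x : Lam) (L R : 'M[Lam]_d) a b (F : 'I_a -> 'I_b -> 'M[Lam]_d) :
  x * \tr (L * (\sum_i \sum_j F i j) * R) = \sum_i \sum_j x * \tr (L * F i j * R).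
Proof.
rewrite [L * _]mulr_sumr mulr_suml raddf_sum mulr_sumr; apply: eq_bigr => i _.
by rewrite [L * _]mulr_sumr mulr_suml raddf_sum mulr_sumr.
Qed.

(** The factor [e * eta] is there because the polarized identities hold only after multiplication by
    these parameters. Extension by zero off the plane of exponents lets sums run over the whole
    cube. *)
Definition cyclic_word A D B C i j k : Lam :=
  (e * eta * \tr (D * A ^+ i * B * A ^+ j * C * A ^+ k)) *+ (i + j + k == 4 * d - 4)%N.

(** On the plane the word has 4d - 4 + 3 odd letters, an odd number. So one of the two blocks D A^i
    and B A^j C A^k is even, and exchanging them under the trace costs no sign. *)
Lemma cyclic_word_rot A D B C i j k :
  mxparity true A -> mxparity true D -> mxparity true B -> mxparity true C ->
  cyclic_word A D B C i j k = cyclic_word A B C D j k i.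
Proof.
move=> hA hD hB hC; rewrite /cyclic_word.
have -> : (i + j + k = j + k + i)%N by lia.
case: eqP => [h|_]; last by rewrite !mulr0n.
congr (_ * _ *+ _).
have hP := mxparityM hD (mxparityX (k := i) hA).
have hQ := mxparityM (mxparityM (mxparityM hB (mxparityX (k := j) hA)) hC) (mxparityX (k := k) hA).
have := mxtrace_parityC hP hQ; rewrite !mulrA => ->.
have -> : ((true (+) odd i) && (true (+) odd j (+) true (+) odd k)) = false.
  have : odd (j + k + i) = false by rewrite h; lia.
  by rewrite !oddD; case: (odd i); case: (odd j); case: (odd k).
by rewrite mul1r.
Qed.

(** For fixed [k] the sum contains the polarized identity for [B] as an inner factor of the word. *)
Lemma cyclic_word_lines A D B C :
  mxparity true A -> mxparity true D -> mxparity true B -> mxparity true C ->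
  lines_vanish d (cyclic_word A D B C).
Proof.
move=> hA hD hB hC k hk; have hs : (2 * d <= (4 * d - 4 - k).+1)%N by lia.
have := odd_polarization hA hB hs; rewrite coef_resolvent2.
set X := \sum_(i < _) _ => h0.
transitivity (e * eta * \tr (D * X * (C * A ^+ k))); last first.
  have hec := scalar_central (even_central he).
  rewrite (even_central he eta) -(mulrA eta e) -(mxtrace_scalarM e) !mulrA hec -(mulrA D) h0.
  by rewrite mulr0 !mul0r mxtrace0 mulr0.
rewrite mxtrace_sum2; do 2 (apply: eq_bigr => ? _).
by rewrite /cyclic_word mulrnAr mulrnAl raddfMn /= mulrnAr !mulrA; congr (_ *+ _); lia.
Qed.

(** For even [k] the matrix C A^k D is even, and its polarized identity gives the line sum with
    signs (-1)^i. Adding the unsigned sum leaves twice the terms with [i] even, and then [j] is even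
    too. *)
Lemma cyclic_word_even_lines A D B C :
  mxparity true A -> mxparity true D -> mxparity true B -> mxparity true C ->
  lines_vanish d
    (fun i j k => cyclic_word A D B C i j k *+ (~~ odd i && ~~ odd j && ~~ odd k)).
Proof.
move=> hA hD hB hC k hk; have hs : (2 * d <= (4 * d - 4 - k).+1)%N by lia.
case ok: (odd k); first by rewrite big1 // => i _; rewrite big1 // => j _; rewrite andbF.
have hW : mxparity false (C * A ^+ k * D).
  by have := mxparityM (mxparityM hC (mxparityX (k := k) hA)) hD; rewrite ok.
have := even_polarization hA hW hs; set X := \sum_(i < _) _ => h0.
have signed : \sum_(i < 2 * d) \sum_(j < 2 * d) (-1) ^+ i * cyclic_word A D B C i j k = 0.
  (* The word is rotated to A^j (C A^k D) A^i B. The blocks exchanged have opposite parities, so no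
     sign appears, and (-1)^j = (-1)^i because i + j is even. *)
  transitivity (e * eta * \tr (1 * X * B)); last first.
    by rewrite -mxtrace_scalarM mul1r mulrA h0 mul0r mxtrace0.
  rewrite mxtrace_sum2 exchange_big; apply: eq_bigr => j _; apply: eq_bigr => i _.
  rewrite /cyclic_word mul1r -mulrnAr.
  have -> : (i + j + k == 4 * d - 4)%N = (j + i == 4 * d - 4 - k)%N by lia.
  case: eqP => [h|_]; last by rewrite !mulr0n mul0r !mxtrace0 !mulr0.
  rewrite !mulr1n.
  have hP := mxparityM (mxparityM hD (mxparityX (k := i) hA)) hB.
  have hQ := mxparityM (mxparityM (mxparityX (k := j) hA) hC) (mxparityX (k := k) hA).
  have trQ := mxtrace_parityC hP hQ; rewrite !mulrA in trQ; rewrite {}trQ.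
  have -> : odd i = odd j by lia.
  have -> : (true (+) odd j (+) true) && (odd j (+) true (+) odd k) = false.
    by rewrite ok; case: (odd j).
  have -> : (-1) ^+ i = (-1) ^+ j :> Lam.
    by rewrite -signr_odd -[RHS]signr_odd; congr (_ ^+ _); lia.
  rewrite expr0 mul1r -[in RHS](mulrA _ _ B) mxtrace_signM.
  by rewrite !(mulrA (A ^+ j)); exact: signrCA.
have unsigned := cyclic_word_lines hA hD hB hC hk.
apply: (@ext_int_torsion_free _ _ 1).
rewrite -[RHS]addr0 -[X in X + _]unsigned -[X in _ + X]signed -big_split -sumrMnl.
apply: eq_bigr => i _; rewrite -big_split -sumrMnl /=; apply: eq_bigr => j _.
have [h|/negPf h] := eqVneq (i + j + k)%N (4 * d - 4)%N; last first.
  by rewrite /cyclic_word h !mulr0n mulr0 !mul0rn addr0.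
have -> : odd j = odd i by lia.
rewrite -signr_odd; case: (odd i); first by rewrite mulr0n mul0rn expr1 mulN1r subrr.
by rewrite mulr1n mulr2n mul1r.
Qed.

(** The lines in the other two directions are reduced to the first by rotating the word. *)
Lemma cyclic_word_sum A D B C :
  mxparity true A -> mxparity true D -> mxparity true B -> mxparity true C ->
  sum3 d (cyclic_word A D B C) = 0.
Proof.
move=> hA hD hB hC.
apply: sum3_eq0 => //.
- exact: ext_int_torsion_free.
- by move=> i j k /negPf h; rewrite /cyclic_word h.
- split.
  + exact: cyclic_word_lines.
  + move=> k hk; rewrite -[RHS](cyclic_word_lines hA hC hD hB hk).
    by do 2 (apply: eq_bigr => ? _); rewrite 2?cyclic_word_rot.
  + move=> k hk; rewrite -[RHS](cyclic_word_lines hA hB hC hD hk).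
    by do 2 (apply: eq_bigr => ? _); rewrite cyclic_word_rot.
- split.
  + exact: cyclic_word_even_lines.
  + move=> k hk; rewrite -[RHS](cyclic_word_even_lines hA hC hD hB hk).
    apply: eq_bigr => i _; apply: eq_bigr => j _; rewrite 2?cyclic_word_rot //.
    by congr (_ *+ nat_of_bool _); rewrite [RHS]andbC [RHS]andbA [RHS]andbC [RHS]andbA.
  + move=> k hk; rewrite -[RHS](cyclic_word_even_lines hA hB hC hD hk).
    apply: eq_bigr => i _; apply: eq_bigr => j _; rewrite cyclic_word_rot //.
    by congr (_ *+ nat_of_bool _); rewrite -andbA andbC.
Qed.

(** The entries are recovered by traces against matrix units; the factor [zeta] makes the test
    matrix [D] odd. *)
Lemma second_order_vanish zeta A B C : parity true zeta ->
  mxparity true A -> mxparity true B -> mxparity true C ->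
  (e * eta * zeta)%:M * (res A * B%:P * res A * C%:P * res A)`_(4 * d - 4) = 0.
Proof.
move=> hz hA hB hC; apply/matrixP => r s; rewrite coef_resolvent3.
set Z := \sum_(i < _) _.
pose D : 'M[Lam]_d := zeta%:M * delta_mx s r.
have hD : mxparity true D.
  have h : mxparity false (delta_mx s r : 'M[Lam]_d).
    by move=> i j; rewrite mxE; case: (_ && _); [exact: parity1 | exact: parity0].
  exact: (mxparityM (mxparity_scalar hz) h).
transitivity (e * eta * \tr (D * Z * 1)).
  rewrite mulr1 /D -(mulrA zeta%:M) mxtrace_scalarM mulrA -[_ * Z in LHS]/(_ *m Z) mul_scalar_mx mxE.
  congr (_ * _); rewrite /mxtrace (bigD1 s) //= big1 => [|i /negPf si].
    rewrite mxE (bigD1 r) //= big1 => [|j /negPf jr]; first by rewrite !mxE !eqxx mul1r !addr0.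
    by rewrite mxE jr andbF mul0r.
  by rewrite mxE big1 // => j _; rewrite mxE si mul0r.
rewrite [RHS]mxE -[RHS](cyclic_word_sum hA hD hB hC) mxtrace_sum2 /sum3.
apply: eq_bigr => i _; apply: eq_bigr => j _.
rewrite [D * _]mulr_sumr mulr_suml raddf_sum mulr_sumr; apply: eq_bigr => k _.
by rewrite /cyclic_word mulr1 mulrnAr raddfMn /= mulrnAr !mulrA.
Qed.

End OddMatrices.

(** * Third order *)

Section ThirdOrder.
Variables (m n : nat).
Local Notation Lam := (ext int m).
Local Notation d := n.+1.
Hypothesis n1 : (1 <= n)%N.
Variables (e e' eta zeta : Lam).
Hypotheses (he : parity false e) (hee : e * e = 0) (he' : parity false e') (hee' : e' * e' = 0).
Hypotheses (heta : parity true eta) (hzeta : parity true zeta).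
Local Notation res A := (resolvent (2 * d) A).

(** The derivative of [second_order_vanish] in the direction [D], obtained by also applying it to
    the odd matrix A + e' D. *)
Lemma third_order_shuffle (A B C D : 'M[Lam]_n.+1) :
  mxparity true A -> mxparity true B -> mxparity true C -> mxparity true D ->
  let r := res A in
  (e * eta * zeta * e')%:M *
    (r * D%:P * r * B%:P * r * C%:P * r + r * B%:P * r * D%:P * r * C%:P * r +
     r * B%:P * r * C%:P * r * D%:P * r)`_(4 * d - 5) = 0.
Proof.
move=> hA hB hC hD r.
have hA' : mxparity true (A + e'%:M * D).
  by apply: mxparityD => //; apply: (mxparityM (mxparity_scalar he') hD).
rewrite scalar_mxM -[_ *m _]/(_ * _).
have -> : (4 * d - 5 = (4 * d - 4).-1)%N by lia.
apply: coef_resolvent3_derivative; last by lia.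
- exact/scalar_central/even_central.
- by rewrite -[_ * _]scalar_mxM hee' raddf0.
- exact: odd_matrix_nilpotent.
- exact: odd_matrix_nilpotent.
- exact: second_order_vanish.
- exact: second_order_vanish.
Qed.
End ThirdOrder.

(** * Products of monomials in at most three generators *)

Section ExtMonomials.
Variables (M : pzRingType) (m : nat).
Implicit Types S T U : {set 'I_m}.
Local Notation v S := (emono S 1 : ext M m).

Lemma emonoE S (x : M) : emono S x = v S * emono set0 x.
Proof. by rewrite emonoM -setI_eq0 setI0 eqxx setU0 grinv0r !mul1r. Qed.

Lemma emono_comm S (x : M) : v S * emono set0 x = emono set0 x * v S.
Proof. by rewrite -emonoE emonoM -setI_eq0 set0I eqxx set0U grinv0l mul1r mulr1. Qed.

Fact emono_additive : zmod_morphism (emono set0 : M -> ext M m).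
Proof. by move=> x y; apply/ffunP => S; rewrite !ffunE; case: eqP; rewrite ?subr0. Qed.
Fact emono_multiplicative : monoid_morphism (emono set0 : M -> ext M m).
Proof.
split; first exact: emono1.
by move=> x y; rewrite emonoM -setI_eq0 set0I eqxx set0U grinv0l mul1r.
Qed.
HB.instance Definition _ := GRing.isZmodMorphism.Build M (ext M m) (emono set0) emono_additive.
HB.instance Definition _ := GRing.isMonoidMorphism.Build M (ext M m) (emono set0) emono_multiplicative.

Lemma mul_emono3 S T U : v S * v T * v U =
  if [&& [disjoint S & T], [disjoint S & U] & [disjoint T & U]]
  then emono (S :|: T :|: U) ((-1) ^+ (grinv S T + (grinv S U + grinv T U))) else 0.
Proof.
have dU : [disjoint S :|: T & U] = [disjoint S & U] && [disjoint T & U].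
  by rewrite -!setI_eq0 setIUl setU_eq0.
rewrite emonoM; case: ifP => dST; last by rewrite mul0r.
rewrite emonoM dU; case: ifP => // /andP[dSU dTU].
by rewrite grinvUl // !mulr1 -exprD addnC.
Qed.

Lemma leq_card_disjoint3 S T U :
  [disjoint S & T] -> [disjoint S & U] -> [disjoint T & U] -> (#|S| + #|T| + #|U| <= m)%N.
Proof.
move=> dST dSU dTU; have <- : #|S :|: T :|: U| = (#|S| + #|T| + #|U|)%N.
  have /eqP dd : (S :|: T) :&: U == set0 by rewrite setIUl setU_eq0 !setI_eq0 dSU.
  move: dST; rewrite -setI_eq0 => /eqP dST.
  by rewrite cardsU dd cardsU dST !cards0 !subn0.
by rewrite -[leqRHS](card_ord m) max_card.
Qed.

(** Three disjoint nonempty sets in at most three points are singletons, and reversing a product of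
    three odd elements is an odd permutation. *)
Lemma mul_emono3_rev S T U : (m <= 3)%N -> S != set0 -> T != set0 -> U != set0 ->
  v T * v U * v S = - (v S * v U * v T).
Proof.
move=> m3; rewrite -!card_gt0 => hS hT hU; rewrite !mul_emono3.
rewrite (disjoint_sym T U) (disjoint_sym T S) (disjoint_sym U S).
have -> : [&& [disjoint U & T], [disjoint S & T] & [disjoint S & U]] =
          [&& [disjoint S & U], [disjoint S & T] & [disjoint U & T]].
  by case: [disjoint U & T]; case: [disjoint S & T]; case: [disjoint S & U].
case: ifP => [/and3P[dSU dST dUT]|]; last by rewrite oppr0.
have hc := leq_card_disjoint3 dSU dST dUT.
have [S1 T1 U1] : [/\ #|S| = 1, #|T| = 1 & #|U| = 1]%N by split; lia.
have -> : T :|: U :|: S = S :|: U :|: T by rewrite -setUA [U :|: S]setUC [RHS]setUC.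
have := grinvC dSU; have := grinvC dST; have := grinvC dUT; rewrite S1 T1 U1 => h1 h2 h3.
apply/ffunP => Z; rewrite !ffunE; case: ifP => _; last by rewrite oppr0.
rewrite -signr_odd -[in RHS]signr_odd.
have -> : odd (grinv T U + (grinv T S + grinv U S)) =
       ~~ odd (grinv S U + (grinv S T + grinv U T)) by lia.
by case: (odd _); rewrite ?opprK.
Qed.

(** Four pairwise disjoint nonempty sets would need four generators. *)
Lemma mul_emono4 S T U Z : (m <= 3)%N -> S != set0 -> T != set0 -> U != set0 -> Z != set0 ->
  v S * v T * v U * v Z = 0.
Proof.
move=> m3; rewrite -!card_gt0 => hS hT hU hZ; rewrite mul_emono3.
case: ifP => [/and3P[dST dSU dTU]|]; last by rewrite mul0r.
rewrite emonoM -setI_eq0 !setIUl !setU_eq0 !setI_eq0; case: ifP => // /andP[/andP[dSZ dTZ] dUZ].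
have dUTZ : [disjoint U :|: T & Z] by rewrite -setI_eq0 setIUl setU_eq0 !setI_eq0 dUZ.
have dSUT : [disjoint S & U :|: T] by rewrite -setI_eq0 setIUr setU_eq0 !setI_eq0 dSU.
have := leq_card_disjoint3 dSUT dSZ dUTZ; rewrite cardsU.
move: dTU; rewrite -setI_eq0 setIC => /eqP->; rewrite cards0; lia.
Qed.

End ExtMonomials.

(** The Neumann series of the inverse of u - c, cut off after the cubic term. *)
Lemma neumann3 (S : pzRingType) (u r c : S) : u * r = 1 -> c * r * c * r * c * r * c * r = 0 ->
  (u - c) * (r + r * c * r + r * c * r * c * r + r * c * r * c * r * c * r) = 1.
Proof.
move=> ur c4; rewrite mulrBl !mulrDr !mulrA ur !mul1r c4 addr0.
by apply/eqP; rewrite subr_eq !addrA.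
Qed.

(** * Expansion of powers by the degree in the generators *)

Section CubicExpansion.
Variables (V : nzRingType) (m N : nat).
Hypotheses (m3 : (m <= 3)%N).
Variables (Y : ext V m) (r : {poly V}) (lam : V).
Hypothesis r_inv : (1 - (Y set0)%:P * 'X) * r = 1.
Implicit Types S T U : {set 'I_m}.
Local Notation v S := (emono S 1 : ext V m).
Local Notation cst := (emono set0 : V -> ext V m).
Local Notation iota := (map_poly cst).
Local Notation nz := (fun S : {set 'I_m} => S != set0).

Lemma coef_inverse (Q : {poly ext V m}) k : (1 - Y%:P * 'X) * Q = 1 -> Q`_k = Y ^+ k.
Proof.
rewrite mulrBl mul1r => /(canRL (subrK _)) QE.
elim: k => [|k IH].
  by rewrite QE -mulrA coefD coefCM coefXM mulr0 addr0 coef1.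
by rewrite QE -mulrA coefD coefCM coefXM /= IH exprS coef1 add0r.
Qed.

Let b : ext V m := \sum_(S | nz S) v S * cst (Y S).
Let R := iota r.
Let q S := (Y S)%:P.

Lemma ext_split : Y = cst (Y set0) + b.
Proof.
rewrite [LHS]ext_decomp (bigD1 set0) //=; congr (_ + _).
by apply: eq_bigr => S _; rewrite emonoE.
Qed.

Lemma iota_comm S Q : (v S)%:P * iota Q = iota Q * (v S)%:P.
Proof. by apply/polyP => k; rewrite coefCM coefMC coef_map /= emono_comm. Qed.

(** Generators commute with coefficients, so each new monomial can be collected on the left. *)
Lemma expand_step (x : ext V m) Q : x%:P * iota Q * b%:P * R =
  \sum_(S | nz S) (x * v S)%:P * iota (Q * q S * r).
Proof.
rewrite /b rmorph_sum mulr_sumr mulr_suml; apply: eq_bigr => S _ /=.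
rewrite !polyCM -(map_polyC cst) !rmorphM /= !mulrA; congr (_ * _ * _).
by rewrite -!mulrA iota_comm.
Qed.

Lemma expand1 : R * b%:P * R = \sum_(S | nz S) (v S)%:P * iota (r * q S * r).
Proof.
rewrite -[X in X * b%:P]mul1r -polyC1 expand_step; apply: eq_bigr => S _; by rewrite mul1r.
Qed.

Lemma expand2 : R * b%:P * R * b%:P * R =
  \sum_(S | nz S) \sum_(T | nz T) (v S * v T)%:P * iota (r * q S * r * q T * r).
Proof.
rewrite expand1 mulr_suml mulr_suml; apply: eq_bigr => S _; exact: expand_step.
Qed.

Lemma expand3 : R * b%:P * R * b%:P * R * b%:P * R =
  \sum_(S | nz S) \sum_(T | nz T) \sum_(U | nz U)
     (v S * v T * v U)%:P * iota (r * q S * r * q T * r * q U * r).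
Proof.
rewrite expand2 mulr_suml mulr_suml; apply: eq_bigr => S _.
rewrite mulr_suml mulr_suml; apply: eq_bigr => T _; exact: expand_step.
Qed.

Lemma expand4 : R * b%:P * R * b%:P * R * b%:P * R * b%:P * R = 0.
Proof.
rewrite expand3 mulr_suml mulr_suml big1 // => S hS.
rewrite mulr_suml mulr_suml big1 // => T hT.
rewrite mulr_suml mulr_suml big1 // => U hU.
by rewrite expand_step big1 // => Z hZ; rewrite mul_emono4 // mul0r.
Qed.

(** Powers of [Y] are the coefficients of the inverse of 1 - Y X, expanded around its degree-zero
    part. Each factor [b] comes with one X, whence the falling indices. *)
Lemma cubic_expansion k : Y ^+ k.+3 = R`_k.+3 + (R * b%:P * R)`_k.+2 +
  (R * b%:P * R * b%:P * R)`_k.+1 + (R * b%:P * R * b%:P * R * b%:P * R)`_k.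
Proof.
pose c := b%:P * 'X.
have UR : (1 - (cst (Y set0))%:P * 'X) * R = 1.
  have := congr1 iota r_inv.
  by rewrite rmorphM rmorphB rmorphM !rmorph1 /= map_polyX (map_polyC cst (Y set0)).
have Xc k' (P Q : {poly ext V m}) : P * 'X^k' * c * Q = P * b%:P * Q * 'X^(k'.+1).
  rewrite /c -!mulrA -(commr_polyX Q) (mulrA b%:P) (mulrA 'X^k').
  by rewrite -(commr_polyXn (b%:P * Q) k') -!mulrA -exprSr.
have c1 : R * c * R = R * b%:P * R * 'X by rewrite -[X in X * c]mulr1 -(expr0 'X) Xc.
have c2 : R * c * R * c * R = R * b%:P * R * b%:P * R * 'X^2 by rewrite c1 (Xc 1).
have c3 : R * c * R * c * R * c * R = R * b%:P * R * b%:P * R * b%:P * R * 'X^3.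
  by rewrite c2 Xc.
(* The vanishing is known with a further [R] in front, which its left inverse removes. *)
have c4 : c * R * c * R * c * R * c * R = 0.
  have : R * c * R * c * R * c * R * c * R = 0 by rewrite c3 Xc expand4 mul0r.
  move/(congr1 (fun Q => (1 - (cst (Y set0))%:P * 'X) * Q)).
  by rewrite mulr0 !mulrA UR mul1r.
rewrite -(@coef_inverse (R + R * c * R + R * c * R * c * R + R * c * R * c * R * c * R)); last first.
  have -> : 1 - Y%:P * 'X = 1 - (cst (Y set0))%:P * 'X - c.
    by rewrite {1}ext_split polyCD mulrDl opprD addrA.
  exact: neumann3.
by rewrite c3 c2 c1 !coefD coefMX /= !coefMXn /= !subSS !subn0.
Qed.

Hypothesis H0 : lam * r`_N.+3 = 0.
Hypothesis H1 : forall S, lam * (r * q S * r)`_N.+2 = 0.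
Hypothesis H2 : forall S T, lam * (r * q S * r * q T * r)`_N.+1 = 0.
Hypothesis H3 : forall S T U,
  lam * (r * q U * r * q S * r * q T * r + r * q S * r * q U * r * q T * r +
         r * q S * r * q T * r * q U * r)`_N = 0.

Lemma cubic_expansion_vanish : cst lam * Y ^+ N.+3 = 0.
Proof.
have scalv (Q : {poly V}) k : lam * Q`_k = 0 -> forall x, GRing.comm (cst lam) x ->
   cst lam * (x%:P * iota Q)`_k = 0.
  move=> h x cx; rewrite coefCM coef_map /= mulrA cx -mulrA -(rmorphM cst) /= h.
  by rewrite rmorph0 mulr0.
have cv S : GRing.comm (cst lam) (v S) by rewrite /GRing.comm emono_comm.
rewrite cubic_expansion expand3 expand2 expand1 !mulrDr.
rewrite {1}/R coef_map /= -(rmorphM cst) /= H0 rmorph0 add0r.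
rewrite coef_sum mulr_sumr big1 ?add0r => [|S _]; last exact: scalv.
rewrite coef_sum mulr_sumr big1 ?add0r => [|S _]; last first.
  rewrite coef_sum mulr_sumr big1 // => T _; apply: scalv => //; exact: commrM.
pose h S T U := cst (lam * (r * q S * r * q T * r * q U * r)`_N).
transitivity (\sum_(S | nz S) \sum_(T | nz T) \sum_(U | nz U) v S * v T * v U * h S T U).
  rewrite coef_sum mulr_sumr; apply: eq_bigr => S _.
  rewrite coef_sum mulr_sumr; apply: eq_bigr => T _.
  rewrite coef_sum mulr_sumr; apply: eq_bigr => U _.
  rewrite coefCM coef_map /= /h rmorphM /= [LHS]mulrA [RHS]mulrA; congr (_ * _).
  by apply: commrM => //; apply: commrM.
have hs S T U : h U S T + h S U T + h S T U = 0.
  by rewrite /h -!raddfD /= -!mulrDr -!coefD H3 raddf0.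
pose X := \sum_(S | nz S) \sum_(T | nz T) \sum_(U | nz U) v S * v T * v U * h U S T.
(* After renaming the indices, [X] and [X'] have the same coefficients [h S T U], on the monomials
   v_T v_U v_S and v_S v_U v_T. These are reverses of each other, so the two sums cancel and the
   shuffle relation [hs] isolates the cubic term. *)
pose X' := \sum_(S | nz S) \sum_(T | nz T) \sum_(U | nz U) v S * v T * v U * h S U T.
have X'E : X' = - X.
  have -> : X = \sum_(S | nz S) \sum_(T | nz T) \sum_(U | nz U) v T * v U * v S * h S T U.
    by rewrite /X; under eq_bigr do rewrite exchange_big /=; rewrite exchange_big.
  rewrite /X' -sumrN; apply: eq_bigr => S hS.
  rewrite exchange_big -sumrN; apply: eq_bigr => T hT.
  rewrite -sumrN; apply: eq_bigr => U hU.
  by rewrite (mul_emono3_rev V m3 hS hT hU) mulNr opprK.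
apply: (addrI (X + X')); rewrite addr0 {2}X'E subrr /X /X' -!big_split big1 // => S _.
rewrite -!big_split big1 // => T _; rewrite -!big_split big1 // => U _ /=.
by rewrite -!mulrDr hs mulr0.
Qed.

End CubicExpansion.

Section OddPower.
Variables (k m n : nat).
Local Notation Lam := (ext int k).
Variables (e e' eta zeta : Lam).
Hypotheses (he : parity false e) (hee : e * e = 0) (he' : parity false e') (hee' : e' * e' = 0).
Hypotheses (heta : parity true eta) (hzeta : parity true zeta).

(** The multiplier collects the parameters of all polarizations: degree 1 uses [e], degree 2 uses
    [e * eta * zeta], degree 3 the whole product. In degree 0 the index lies beyond the degree of
    the resolvent. *)
Lemma odd_pow_vanish (Y : ext 'M[Lam]_n.+1 m) : (1 <= n)%N -> (m <= 3)%N ->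
  (forall S, mxparity true (Y S)) ->
  emono set0 (e * eta * zeta * e')%:M * Y ^+ (4 * n.+1 - 2) = 0.
Proof.
move=> n1 m3 Yodd; have -> : (4 * n.+1 - 2 = (4 * n.+1 - 5).+3)%N by lia.
have ec := even_central he; have e'c := even_central he'.
apply: (@cubic_expansion_vanish _ _ _ m3 Y (resolvent (2 * n.+1) (Y set0))).
- by apply: mul_resolvent; apply: odd_matrix_nilpotent.
- by rewrite coef_poly ifF ?mulr0 //; lia.
- move=> S; have -> : (e * eta * zeta * e')%:M = (eta * zeta * e')%:M * e%:M :> 'M[Lam]_n.+1.
    by rewrite -[RHS]scalar_mxM -ec !mulrA.
  by rewrite -(mulrA _ e%:M) odd_polarization ?mulr0 //; lia.
- move=> S T; have -> : (4 * n.+1 - 5).+1 = (4 * n.+1 - 4)%N by lia.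
  have -> : (e * eta * zeta * e')%:M = e'%:M * (e * eta * zeta)%:M :> 'M[Lam]_n.+1.
    by rewrite -[RHS]scalar_mxM e'c.
  by rewrite -(mulrA e'%:M) second_order_vanish ?mulr0.
by move=> S T U; apply: third_order_shuffle.
Qed.

End OddPower.

(** * Standard polynomials *)

(** Stated for any ring, so that it can be transported along ring morphisms. *)
Definition standard (W : pzRingType) k (y : 'I_k -> W) : W :=
  \sum_(s : 'S_k) (-1) ^+ s * \prod_(i < k) y (s i).

Lemma prodr_enum (W : pzRingType) k (y : 'I_k -> W) :
  \prod_(i <- enum 'I_k) y i = \prod_(i < k) y i.
Proof. by rewrite enumT unlock. Qed.

Lemma std_polyE (R : comPzRingType) m n k (x : 'I_k -> 'M[grass R m]_n) :
  std_poly x = standard (x : 'I_k -> 'M[ext R m]_n).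
Proof.
have mulE (A B : 'M[ext R m]_n) : grmxmul A B = A * B.
  by apply/matrixP => i j; rewrite !mxE.
have oneE : grmx1 R m n = (1 : 'M[ext R m]_n).
  apply/matrixP => i j; rewrite !mxE; by case: (i == j).
have prodE (l : seq 'M[ext R m]_n) : grmxprod l = \prod_(A <- l) A.
  by elim: l => [|A l IH] /=; rewrite ?big_nil ?big_cons ?oneE // mulE -IH.
have enumE (y : 'I_k -> 'M[ext R m]_n) :
    grmxprod [seq y i | i <- enum 'I_k] = \prod_(i < k) y i.
  by rewrite prodE big_map prodr_enum.
apply: eq_bigr => s _; rewrite mulr_sign -(enumE (fun i => x (s i))).
by case: (odd_perm s).
Qed.

Lemma standard_morph (W W' : pzRingType) (f : {rmorphism W -> W'}) k (y : 'I_k -> W) :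
  f (standard y) = standard (f \o y).
Proof.
rewrite rmorph_sum; apply: eq_bigr => s _.
by rewrite rmorphM rmorph_sign rmorph_prod.
Qed.

(** * Alternating products of odd elements *)

Section Alternating.
Variables (m k : nat) (theta : 'I_k -> ext int m).
Hypothesis theta_odd : forall i, parity true (theta i).

Let P (l : seq 'I_k) := \prod_(i <- l) theta i.

Lemma parity_prod l : parity (odd (size l)) (P l).
Proof.
rewrite /P; elim: l => [|i l IH]; first by rewrite big_nil; apply: parity1.
by rewrite big_cons; apply: (parityM (theta_odd i) IH).
Qed.

(** The two exchanged factors each pass the word between them, so its parity cancels and only the
    sign of their own exchange remains. *)
Lemma prod_swap l1 l2 l3 a b :
  P (l1 ++ a :: l2 ++ b :: l3) = - P (l1 ++ b :: l2 ++ a :: l3).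
Proof.
rewrite /P !big_cat !big_cons !big_cat !big_cons /= -mulrN; congr (_ * _).
rewrite !mulrA -mulNr; congr (_ * _).
have ha := theta_odd a; have hb := theta_odd b; have hw := @parity_prod l2; rewrite -/(P l2).
rewrite -mulrA (parityC ha (parityM hw hb)) (parityC hb hw) mulrA -/(P l2).
by case: (odd _); rewrite /= ?mul1r ?mulN1r ?opprK ?mulNr ?opprK.
Qed.

Lemma prod_tperm (f : 'I_k -> 'I_k) i j : i != j ->
  \prod_l theta (f (tperm i j l)) = - \prod_l theta (f l).
Proof.
have PE (g : 'I_k -> 'I_k) : \prod_l theta (g l) = P [seq g l | l <- enum 'I_k].
  by rewrite /P big_map prodr_enum.
rewrite !PE; have := enum_uniq 'I_k; have := mem_enum 'I_k i; have := mem_enum 'I_k j.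
move: (enum 'I_k) => l; rewrite !inE.
wlog: i j / (index i l < index j l)%N.
  move=> H jl il ul ij; have [h|h|h] := ltngtP (index i l) (index j l).
  - exact: H.
  - by rewrite tpermC; apply: H => //; rewrite eq_sym.
  - by move: ij; rewrite -(nth_index i il) h (nth_index i jl) eqxx.
move=> hij jl il; case/splitPr: il hij jl => l1 l2 hij.
rewrite mem_cat inE => jl ul ij.
have j2 : j \in l2.
  case/or3P: jl => // [j1|/eqP e]; last by rewrite e eqxx in ij.
  move: hij; rewrite !index_cat j1.
  have i1 : i \notin l1.
    by move: ul; rewrite cat_uniq => /and3P[_ /hasPn/(_ i)]; rewrite mem_head => /(_ isT).
  rewrite (negPf i1) => h; have := index_mem j l1; rewrite j1; lia.
case/splitPr: j2 ul {hij jl} => l3 l4 ul.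
have same : forall l', i \notin l' -> j \notin l' ->
    [seq f (tperm i j x) | x <- l'] = [seq f x | x <- l'].
  move=> l' il' jl'; apply/eq_in_map => x xl; rewrite tpermD //; first by apply: contraNneq il' => ->.
  by apply: contraNneq jl' => ->.
move: ul; rewrite cat_uniq /= !cat_uniq /= !has_cat /= !negb_or !mem_cat !inE !negb_or.
case/and5P=> _ /and4P[i1 _ j1 _] /and3P[i3 _ i4] _ /and3P[/andP[j3 _] j4 _].
rewrite !map_cat /= !map_cat /= !same // tpermL tpermR; exact: prod_swap.
Qed.

(** Transposing two indices with equal images preserves the product and negates it; torsion-freeness
    concludes. *)
Lemma prod_noninjective (f : 'I_k -> 'I_k) : ~~ injectiveb f -> \prod_l theta (f l) = 0.
Proof.
move/injectivePn => [i [j ij fij]]; apply: (@ext_int_torsion_free _ _ 1).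
rewrite mulr2n -{1}[\prod_l _]opprK -(prod_tperm f ij).
have -> : \prod_l theta (f (tperm i j l)) = \prod_l theta (f l).
  by apply: eq_bigr => l _; case: tpermP => // ->; rewrite ?fij.
by rewrite addNr.
Qed.

Lemma prod_perm (s : 'S_k) : \prod_l theta (s l) = (-1) ^+ s * \prod_l theta l.
Proof.
have [ts -> dts] := prod_tpermP s; elim: ts dts => [|t ts IH] /=.
  by rewrite big_nil odd_perm1 mul1r => _; apply: eq_bigr => l _; rewrite perm1.
case/andP=> dt /IH{IH} IH; rewrite big_cons odd_mul_tperm dt.
under eq_bigr do rewrite permM.
rewrite (prod_tperm (fun l => (\prod_(t0 <- ts) tperm t0.1 t0.2)%g l)) // IH.
by rewrite -mulNr -signrN.
Qed.

End Alternating.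

(** In the expanded power the words with a repeated index vanish; the others are permutations, and
    reordering their [theta] factors produces the signs of the standard polynomial. *)
Lemma pow_sum_standard m (W : pzRingType) (h : {rmorphism ext int m -> W}) k
    (theta : 'I_k -> ext int m) (y : 'I_k -> W) :
  (forall i, parity true (theta i)) -> (forall x i, GRing.comm (h x) (y i)) ->
  (\sum_i h (theta i) * y i) ^+ k = h (\prod_i theta i) * standard y.
Proof.
move=> tho hc.
rewrite -[X in _ ^+ X]card_ord -prodr_const bigA_distr_bigA /=.
have termE (f : {ffun 'I_k -> 'I_k}) : \prod_i (h (theta (f i)) * y (f i)) =
    h (\prod_i theta (f i)) * \prod_i y (f i).
  by rewrite prodrM_comm ?rmorph_prod // => i j _ _; apply: hc.
rewrite (eq_bigr _ (fun f _ => termE f)) (bigID (fun f : {ffun _} => injectiveb f)) /=.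
rewrite [X in _ + X]big1 ?addr0 => [|f /(prod_noninjective tho)->]; last by rewrite rmorph0 mul0r.
rewrite mulr_sumr.
rewrite (reindex (fun s : 'S_k => pval s)) /=; last first.
  (* Injective functions are in bijection with permutations; on them the default [1%g] is never
     taken. *)
  exists (insubd (1%g : 'S_k)) => [s _|f fi]; first exact: valKd.
  exact: (insubdK (1%g : 'S_k) fi).
apply: eq_big => [s|s _]; first exact: (valP s).
have -> : \prod_i theta (pval s i) = \prod_i theta (s i) by apply: eq_bigr => i _; rewrite pvalE.
rewrite prod_perm // rmorphM rmorph_sign -mulrA.
have -> : \prod_i y (pval s i) = \prod_i y (s i) by apply: eq_bigr => i _; rewrite pvalE.
exact: signrCA.
Qed.

(** * Matrices over exterior algebras *)

Section ExtMatrix.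
Variables (R S : pzRingType) (f : {rmorphism R -> S}) (m n : nat).

(** Identifies matrices over an exterior algebra with exterior elements having matrix coefficients,
    and changes scalars along [f] at the same time. *)
Definition ext_of_mx (x : 'M[ext R m]_n) : ext 'M[S]_n m :=
  [ffun T => \matrix_(k, l) f (x k l T)].

Fact ext_of_mx_additive : zmod_morphism ext_of_mx.
Proof. by move=> x y; apply/ffunP => T; apply/matrixP => k l; rewrite !(ffunE, mxE) rmorphB. Qed.

Fact ext_of_mx_multiplicative : monoid_morphism ext_of_mx.
Proof.
split.
  apply/ffunP => T; apply/matrixP => k l; rewrite !(ffunE, mxE).
  case kl: (k == l); rewrite ?mulr1n ?mulr0n ffunE;
    by case: (T == set0); rewrite ?mxE ?kl ?rmorph1 ?rmorph0.
move=> x y; apply/ffunP => U; apply/matrixP => k l.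
rewrite [ext_of_mx (x * y) U]ffunE mxE [(x * y) k l]mxE ext_sumE rmorph_sum [in RHS]ffunE summxE.
pose F (S' T : {set 'I_m}) r := f (if (S' :&: T == set0) && (S' :|: T == U)
  then (-1) ^+ grinv S' T * x k r S' * y r l T else 0).
transitivity (\sum_r \sum_(S' : {set 'I_m}) \sum_(T : {set 'I_m}) F S' T r).
  by apply: eq_bigr => r _; rewrite ffunE rmorph_sum; apply: eq_bigr => S' _; rewrite rmorph_sum.
rewrite exchange_big; apply: eq_bigr => S' _; rewrite exchange_big summxE; apply: eq_bigr => T _.
rewrite /F; case: ifP => _; last by rewrite mxE big1 // => r _; rewrite rmorph0.
rewrite -signr_odd -[in RHS]signr_odd -[in RHS]mulrA mulr_sign.
transitivity (((-1) ^+ odd (grinv S' T) : S) * (ext_of_mx x S' * ext_of_mx y T) k l).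
  rewrite mxE mulr_sumr; apply: eq_bigr => r _.
  by rewrite -mulrA !rmorphM rmorph_sign !ffunE !mxE.
by rewrite mulr_sign; case: (odd _); rewrite ?mxE.
Qed.
HB.instance Definition _ := GRing.isZmodMorphism.Build _ _ ext_of_mx ext_of_mx_additive.
HB.instance Definition _ := GRing.isMonoidMorphism.Build _ _ ext_of_mx ext_of_mx_multiplicative.
End ExtMatrix.

(** * Generators as parameters *)

Section Generators.
Variable k : nat.
Local Notation g i := (emono [set i] 1 : ext int k).

Lemma parity_gen i : parity true (g i).
Proof. by have := @parity_emono int k [set i] 1; rewrite cards1. Qed.

(** The sign is left unspecified: it matters only that it is invertible. *)
Lemma prod_gen (l : seq 'I_k) : uniq l ->
  exists b : bool, \prod_(i <- l) g i = emono [set i in l] ((-1) ^+ b).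
Proof.
elim: l => [|i l IH] /=.
  by exists false; rewrite big_nil -emono1; congr emono; apply/setP => x; rewrite !inE.
case/andP=> il /IH[b E]; exists (odd (grinv [set i] [set j in l]) (+) b).
rewrite big_cons E emonoM disjoints1 inE il mulr1 -signr_odd signr_addb.
by congr emono; apply/setP => x; rewrite !inE.
Qed.

(** Removes all parameters at the end, by reading the coordinate on the top monomial. *)
Lemma prod_gen_mul_eq0 (z : int) : (\prod_(i < k) g i) * emono set0 z = 0 -> z = 0.
Proof.
have [b E] := prod_gen (enum_uniq 'I_k); rewrite prodr_enum in E.
rewrite {}E emonoM -setI_eq0 setI0 eqxx setU0 grinv0r mul1r.
move/ffunP/(_ [set i in enum 'I_k]); rewrite !ffunE eqxx => /eqP.
by rewrite mulf_eq0 signr_eq0 /= => /eqP.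
Qed.

Lemma mul_pair_gen i j : g i * g j * (g i * g j) = 0.
Proof.
rewrite -mulrA (mulrA (g j)) (parityC (parity_gen j) (parity_gen i)) /=.
have gg : g i * g i = 0 by rewrite emonoM disjoints1 inE eqxx.
by rewrite mulN1r mulNr mulrN !mulrA gg !mul0r oppr0.
Qed.

End Generators.

Lemma emono0_mulE (M : pzRingType) m (x : M) (w : ext M m) (S : {set 'I_m}) :
  (emono set0 x * w) S = x * w S.
Proof.
rewrite {1}(ext_decomp w) mulr_sumr ext_sumE (bigD1 S) //= big1 => [|T /negPf TS].
  by rewrite emonoM -setI_eq0 set0I eqxx set0U grinv0l mul1r ffunE eqxx addr0.
by rewrite emonoM -setI_eq0 set0I eqxx set0U ffunE eq_sym TS.
Qed.

Section ExtScalar.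
Variables (L : pzRingType) (m n : nat).

Definition ext_scalar (y : L) : ext 'M[L]_n m := emono set0 y%:M.

Fact ext_scalar_additive : zmod_morphism ext_scalar.
Proof. by move=> y z; rewrite /ext_scalar !raddfB. Qed.

Fact ext_scalar_multiplicative : monoid_morphism ext_scalar.
Proof.
by split=> [|y z]; rewrite /ext_scalar ?scalar_mxM -?[_ *m _]/(_ * _) ?rmorphM -?emono1.
Qed.

HB.instance Definition _ := GRing.isZmodMorphism.Build _ _ ext_scalar ext_scalar_additive.
HB.instance Definition _ := GRing.isMonoidMorphism.Build _ _ ext_scalar ext_scalar_multiplicative.

Lemma ext_scalarE y (w : ext 'M[L]_n m) (S : {set 'I_m}) k l :
  (ext_scalar y * w) S k l = y * w S k l.
Proof. by rewrite emono0_mulE -[_ * _]/(_ *m _) mul_scalar_mx mxE. Qed.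

Lemma ext_scalar_comm (R : pzRingType) (f : {rmorphism R -> L}) y (x : 'M[ext R m]_n) :
  (forall z z', GRing.comm (f z) z') -> GRing.comm (ext_scalar y) (ext_of_mx f x).
Proof.
move=> fc; rewrite /GRing.comm {1 2}(ext_decomp (ext_of_mx f x)) mulr_suml mulr_sumr.
apply: eq_bigr => S _.
rewrite !emonoM -!setI_eq0 setI0 set0I eqxx setU0 set0U grinv0l grinv0r !mul1r.
congr emono; apply/matrixP => i j; rewrite -[_%:M * _]/(_ *m _) mul_scalar_mx mxE.
rewrite [RHS]mxE (bigD1 j) //= big1 ?addr0 => [|l lj]; last by rewrite [y%:M l j]mxE (negPf lj) mulr0.
by rewrite [y%:M j j]mxE eqxx mulr1n ffunE mxE fc.
Qed.
End ExtScalar.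

(** The bracketing matches [e * eta * zeta * e'], with [e] and [e'] products of two generators. *)
Lemma prodr_ord6 (W : pzRingType) (a : 'I_6 -> W) (o := fun j h => a (@Ordinal 6 j h)) :
  \prod_(j < 6) a j =
  o 0%N isT * o 1%N isT * o 2%N isT * o 3%N isT * (o 4%N isT * o 5%N isT).
Proof.
rewrite !big_ord_recl big_ord0 mulr1 !mulrA.
do 5 (congr (_ * _); last by congr (a _); apply: val_inj).
by congr (a _); apply: val_inj.
Qed.

Lemma standard_int_eq0 m n (x : 'I_(4 * n.+1 - 2) -> 'M[ext int m]_n.+1) :
  (1 <= n)%N -> (m <= 3)%N -> standard x = 0.
Proof.
set N := (4 * n.+1 - 2)%N in x * => n1 m3.
(* Six generators serve the polarizations: two each for [e] and [e'], one each for [eta] and [zeta].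
   The other N are the [theta i]. *)
pose Lam := ext int (6 + N).
pose g i : Lam := emono [set i] 1.
pose a j := g (lshift N j).
pose theta i := g (rshift 6 i).
pose o j hj := a (@Ordinal 6 j hj).
have go i : parity true (g i) by exact: parity_gen.
pose phi := @ext_of_mx int Lam (emono set0) m n.+1.
pose h := @ext_scalar Lam m n.+1.
pose Y := \sum_i h (theta i) * phi (x i).
have cstc (z : int) (y : Lam) : GRing.comm (emono set0 z) y.
  by apply: even_central; have := @parity_emono int (6 + N) set0 z; rewrite cards0.
have YN : Y ^+ N = h (\prod_i theta i) * standard (phi \o x).
  apply: pow_sum_standard => [i|y i]; first exact: go.
  exact: ext_scalar_comm.
have Yodd S : mxparity true (Y S).
  move=> i j; rewrite ext_sumE summxE; apply: parity_sum => l _.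
  rewrite ext_scalarE ffunE mxE.
  have := parityM (go (rshift 6 l)) (@parity_emono int _ set0 (x l i j S)).
  by rewrite cards0.
pose e := o 0%N isT * o 1%N isT; pose eta := o 2%N isT; pose zeta := o 3%N isT.
pose e' := o 4%N isT * o 5%N isT.
have := @odd_pow_vanish _ m n e e' eta zeta (parityM (go _) (go _)) (mul_pair_gen _ _)
  (parityM (go _) (go _)) (mul_pair_gen _ _) (go _) (go _) Y n1 m3 Yodd.
(* The multiplier times the product of the [theta i] contains every generator of [Lam] once. *)
rewrite -/(ext_scalar m n.+1 _) -/N YN -prodr_ord6 -standard_morph mulrA -rmorphM => h0.
apply/matrixP => i j; apply/ffunP => S; rewrite mxE ffunE; apply: (@prod_gen_mul_eq0 (6 + N)).
rewrite big_split_ord /=.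
have := congr1 (fun w : ext 'M[Lam]_n.+1 m => w S i j) h0.
by rewrite ext_scalarE !ffunE !mxE.
Qed.

(** * Reduction to integer coefficients by multilinearity *)

Lemma standard_multilinear (R : comPzRingType) (W : pzRingType) (rho : {rmorphism R -> W})
    (C : finType) (B : C -> W) k (r : 'I_k -> C -> R) :
  (forall z c, GRing.comm (rho z) (B c)) ->
  (forall f : 'I_k -> C, standard (B \o f) = 0) ->
  standard (fun i => \sum_c rho (r i c) * B c) = 0.
Proof.
move=> rc B0; rewrite /standard.
transitivity (\sum_(f : {ffun 'I_k -> C}) rho (\prod_i r i (f i)) * standard (B \o f)); last first.
  by rewrite big1 // => f _; rewrite B0 mulr0.
under [RHS]eq_bigr do rewrite mulr_sumr.
rewrite exchange_big; apply: eq_bigr => s _ /=.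
rewrite bigA_distr_bigA mulr_sumr /=.
(* Composing the choice function with [s] makes the coefficient product independent of [s], so it
   factors out of the alternating sum. *)
rewrite (reindex (fun f : {ffun 'I_k -> C} => [ffun i => f (s i)])) /=; last first.
  exists (fun f : {ffun 'I_k -> C} => [ffun i => f (s^-1%g i)]) => f _;
    by apply/ffunP => i; rewrite !ffunE ?permK ?permKV.
apply: eq_bigr => f _; rewrite prodrM_comm => [|i j _ _]; last exact: rc.
rewrite -rmorph_prod.
have -> : \prod_i r (s i) ([ffun i0 => f (s i0)] i) = \prod_i r i (f i).
  by rewrite [RHS](reindex_perm s); apply: eq_bigr => i _; rewrite ffunE.
have -> : \prod_i B ([ffun i0 => f (s i0)] i) = \prod_i (B \o f) (s i).
  by apply: eq_bigr => i _; rewrite ffunE.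
exact: signrCA.
Qed.

(** Matrix units times monomials span over [R] and come from integer matrices. Passing through [psi]
    lets the scalars of [R] act by a ring morphism into the same ring. *)
Lemma standard_of_int (R : comPzRingType) m n k :
  (forall x : 'I_k -> 'M[ext int m]_n, standard x = 0) ->
  forall x : 'I_k -> 'M[ext R m]_n, standard x = 0.
Proof.
move=> x0 x.
pose psi := @ext_of_mx R R idfun m n.
have psi_inj : injective psi.
  move=> y z /ffunP yz; apply/matrixP => i j; apply/ffunP => S.
  by move/matrixP: (yz S) => /(_ i j); rewrite !ffunE !mxE.
apply: psi_inj; have -> : psi 0 = 0 by exact: raddf0.
have -> : psi (standard x) = standard (psi \o x) by exact: standard_morph.
pose C := ('I_n * 'I_n * {set 'I_m})%type.
pose beta (c : C) : 'M[ext int m]_n :=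
  \matrix_(i, j) (if (i, j) == c.1 then emono c.2 1 else 0).
pose B := @ext_of_mx int R intr m n \o beta.
have xE i : psi (x i) = \sum_(c : C) ext_scalar m n (x i c.1.1 c.1.2 c.2) * B c.
  apply/ffunP => S; apply/matrixP => a b; rewrite ffunE mxE ext_sumE summxE.
  rewrite (bigD1 (a, b, S)) //= big1 ?addr0.
    by rewrite ext_scalarE !(ffunE, mxE) eqxx ffunE eqxx mulr1.
  case=> -[a' b'] S' /= ne; rewrite ext_scalarE !(ffunE, mxE).
  case: eqP => [[ea eb]|_]; rewrite ffunE ?mulr0 //.
  case: eqP => [eS|_]; last by rewrite mulr0.
  by move: ne; rewrite ea eb eS eqxx.
transitivity (standard (fun i => \sum_(c : C) ext_scalar m n (x i c.1.1 c.1.2 c.2) * B c)).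
  apply: eq_bigr => s _; congr (_ * _); apply: eq_bigr => i _; exact: xE.
apply: standard_multilinear => [z c|f].
  by apply: ext_scalar_comm => y y'; apply: mulrC.
by rewrite -(standard_morph (@ext_of_mx int R intr m n) (beta \o f)) x0 rmorph0.
Qed.

Theorem theorem1p2 (R : comPzRingType) (n : nat) (hn : (2 <= n)%N) :
  std_identity R 2 n (4 * n - 2) /\ std_identity R 3 n (4 * n - 2).
Proof.
case: n hn => [//|n] hn; split=> x; rewrite std_polyE; apply: standard_of_int => y.
  exact: standard_int_eq0.
exact: standard_int_eq0.
Qed.
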